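(* Let $P\subset\mathbb{R}^2$ be a polygon with area $|P|$, boundary length $|\partial P|$ and interior angles $\gamma_1,\dots,\gamma_n$, let $0<\alpha<1$, and let $P_\alpha$ be a disjoint union of (congruent copies of) the sets $\alpha^jP$, $j\in\{0,1,2,\dots\}$. Put $|P_\alpha|=(1-\alpha^2)^{-1}|P|$, $|\partial P_\alpha|=(1-\alpha)^{-1}|\partial P|$, and $V(P)=\sum_{i=1}^n\frac{\pi^2-\gamma_i^2}{24\pi\gamma_i}$. Let $d_1(P),d_2(P)>0$ be constants such that $$\left|Z_P(t)-\frac{|P|}{4\pi t}+\frac{|\partial P|}{8(\pi t)^{1/2}}-V(P)\right|\le d_1(P)e^{-d_2(P)/t},\qquad t>0.$$ Then there exists a $2\log(1/\alpha)$-periodic function $\pi_{\alpha,P}$ such that for $t\downarrow0$, $$Z_{P_\alpha}(t)=\frac{|P_\alpha|}{4\pi t}-\frac{|\partial P_\alpha|}{8(\pi t)^{1/2}}+c_{\alpha,P}\log t+\pi_{\alpha,P}(\log t)+O\!\left(e^{-d_2(P)/(\alpha^2t)}\right),$$ where $$c_{\alpha,P}=\frac{V(P)}{2\log\alpha}.$$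
   Context: A polygon is a bounded region in $\mathbb{R}^2$, not necessarily connected or simply connected, such that each component of its boundary consists of vertices connected by straight line segments; $\gamma_i$ is the inward pointing angle at the $i$-th vertex, $|P|$ is the area and $|\partial P|$ is the sum of the lengths of the components of the boundary. $\alpha P=\{\alpha x:x\in P\}$. For a planar set $M$ with Dirichlet Laplacian having eigenvalues $\lambda_1(M)\le\lambda_2(M)\le\cdots$ (with multiplicity), the heat trace is $Z_M(t)=\sum_{j\ge1}e^{-t\lambda_j(M)}$, $t>0$; it is additive over disjoint unions. It is known (van den Berg–Srisatkunarajah) that constants $d_1(P),d_2(P)$ as in the claim exist for every polygon $P$. *)

(* Defs.v *)
(* MathComp-Analysis; R : realType throughout. *)
From HB Require Import structures.
From mathcomp Require Import all_boot all_order all_algebra.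
From mathcomp Require Import all_classical all_reals all_analysis.
Set Implicit Arguments.
Unset Strict Implicit.
Unset Printing Implicit Defensive.
Import Order.TTheory GRing.Theory Num.Theory.
Import numFieldNormedType.Exports.
Local Open Scope classical_set_scope.
Local Open Scope ring_scope.

(* The library norm on R * R is the sup norm; it is used only for the topology.
   Lengths, angles and isometries are Euclidean. *)
Definition plane (R : realType) := (R * R)%type.

Notation leb2 R := (@lebesgue_measure R \x @lebesgue_measure R)%E.

Section Geometry.
Context {R : realType}.
Implicit Types (u w p v q x : plane R) (P : set (plane R)) (e f : plane R * plane R).

Definition dot u w : R := u.1 * w.1 + u.2 * w.2.
Definition cross u w : R := u.1 * w.2 - u.2 * w.1.
Definition enorm u : R := Num.sqrt (dot u u).
Definition edist u w : R := enorm (u - w).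

Definition euclidean_isometry (T : plane R -> plane R) : Prop :=
  forall u w, edist (T u) (T w) = edist u w.

Definition dilation (a : R) P : set (plane R) := [set a *: x | x in P].

Definition segment e : set (plane R) :=
  [set x | exists2 s : R, 0 <= s <= 1 & x = e.1 + s *: (e.2 - e.1)].

(* Angle in ]0, 2 pi] of the counterclockwise rotation taking the direction of u
   to that of w; equal directions give 2 pi. *)
Definition ccw_angle u w : R :=
  let a := acos (dot u w / (enorm u * enorm w)) in
  if 0 < cross u w then a else 2 * pi - a.

(* A closed chain is the cyclic list of its vertices; [:: a; b] is the chain
   going from a to b and back.  A corner is ((previous vertex, vertex), next). *)
Definition edges (c : seq (plane R)) : seq (plane R * plane R) := zip c (rot 1 c).
Definition corners (c : seq (plane R)) : seq (plane R * plane R * plane R) :=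
  zip (zip (rotr 1 c) c) (rot 1 c).

Definition vertex (k : plane R * plane R * plane R) : plane R := k.1.2.

(* Chains are traversed with the region on the left, so the inward pointing
   angle runs counterclockwise from the outgoing to the incoming edge. *)
Definition inward_angle (k : plane R * plane R * plane R) : R :=
  ccw_angle (k.2 - vertex k) (k.1.1 - vertex k).

Definition in_sector (k : plane R * plane R * plane R) x : bool :=
  (x != vertex k) && (ccw_angle (k.2 - vertex k) (x - vertex k) < inward_angle k).

Definition all_edges (b : seq (seq (plane R))) := flatten [seq edges c | c <- b].
Definition all_corners (b : seq (seq (plane R))) := flatten [seq corners c | c <- b].

(* P is a polygon whose boundary is traversed by the closed chains b.
   The chains form a plane graph; vertices with angle pi are allowed, so edges
   may be subdivided at will.  The last field says that near each vertex P is
   the disjoint union of the sectors at the corners located there; thus a vertex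
   may carry several corners, and a slit (a segment with P on both sides) is
   traversed once in each direction. *)
Record polygon P (b : seq (seq (plane R))) : Prop := Polygon {
  polygon_nonempty : P !=set0;
  polygon_open : open P;
  polygon_bounded : bounded_set P;
  polygon_edge_neq : forall e, e \in all_edges b -> e.1 != e.2;
  polygon_frontier :
    closure P `\` P = \bigcup_(e in [set` all_edges b]) segment e;
  polygon_plane_graph : forall e f x, e \in all_edges b -> f \in all_edges b ->
    segment e x -> segment f x ->
    [\/ e = f, e = (f.2, f.1) |
        x \in [:: e.1; e.2] /\ x \in [:: f.1; f.2]];
  polygon_corners : forall k, k \in all_corners b ->
    \forall x \near vertex k,
      count (fun l => (vertex l == vertex k) && in_sector l x) (all_corners b)
      = (x \in P) :> nat }.

Definition area P : R := fine (leb2 R P).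

Definition perimeter (b : seq (seq (plane R))) : R :=
  \sum_(e <- all_edges b) edist e.1 e.2.

Definition corner_constant (b : seq (seq (plane R))) : R :=
  \sum_(k <- all_corners b)
    (pi ^+ 2 - inward_angle k ^+ 2) / (24 * pi * inward_angle k).

End Geometry.

Section DirichletLaplacian.
Context {R : realType}.
Implicit Types (M : set (plane R)) (phi u f : plane R -> R).

Definition partial (i : bool) phi : plane R -> R :=
  fun x => 'D_(if i then (0, 1) else (1, 0)) phi x.

Definition smooth phi : Prop :=
  forall (s : seq bool) x, differentiable (foldr partial phi s) x.

(* C_c^oo(M) *)
Definition test_function M phi : Prop :=
  [/\ smooth phi, compact (closure [set x | phi x != 0]) &
      closure [set x | phi x != 0] `<=` M].

Definition L2_cvg (v : nat -> plane R -> R) u : Prop :=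
  ('N[leb2 R]_(2%:E)[EFin \o (v n \- u)%R])%E @[n --> \oo] --> 0%E.

(* u belongs to H^1_0(M), the H^1-closure of C_c^oo(M), with weak gradient g.
   Functions on M are extended by 0 to the plane. *)
Definition H10 M u (g : bool -> plane R -> R) : Prop :=
  [/\ measurable_fun setT u, forall i, measurable_fun setT (g i) &
      exists v : nat -> plane R -> R,
        [/\ forall n, test_function M (v n), L2_cvg v u &
            forall i, L2_cvg (fun n => partial i (v n)) (g i)]].

(* Graph of the Dirichlet Laplacian, - Delta u = f: the self-adjoint operator of
   the Dirichlet form on H^1_0(M). *)
Definition dirichlet_laplacian M u f : Prop :=
  exists2 g, H10 M u g &
    forall phi, test_function M phi ->
      \int[leb2 R]_x (g false x * partial false phi x + g true x * partial true phi x)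
      = \int[leb2 R]_x (f x * phi x).

Definition dirichlet_eigenspace M (mu : R) : set (plane R -> R) :=
  [set u | dirichlet_laplacian M u (fun x => mu * u x)].

Definition ae_free n (u : 'I_n -> plane R -> R) : Prop :=
  forall a : 'I_n -> R,
    {ae leb2 R, forall x, \sum_(i < n) a i * u i x = 0} -> forall i, a i = 0.

(* Dimension in [0, +oo] of the eigenspace, modulo equality almost everywhere;
   it is 0 when mu is not an eigenvalue. *)
Definition multiplicity M (mu : R) : \bar R :=
  ereal_sup [set (n%:R)%:E | n in
    [set n : nat | exists u : 'I_n -> plane R -> R,
       (forall i, dirichlet_eigenspace M mu (u i)) /\ ae_free u]].

Definition eigenvalue_count M (mu : R) : \bar R :=
  \esum_(nu in [set nu : R | nu <= mu]) multiplicity M nu.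

(* The eigenvalues in nondecreasing order, repeated according to multiplicity:
   dirichlet_eigenvalue M j is lambda_(j+1)(M), the least mu with eigenvalue_count M mu
   at least j + 1; it is +oo if there are at most j eigenvalues. *)
Definition dirichlet_eigenvalue M (j : nat) : \bar R :=
  ereal_inf [set mu%:E | mu in
    [set mu : R | (j.+1%:R%:E <= eigenvalue_count M mu)%E]].

Definition heat_trace M (t : R) : \bar R :=
  (\sum_(0 <= j <oo) expeR (- (t%:E * dirichlet_eigenvalue M j)))%E.

End DirichletLaplacian.

(* Main.v *)
(* Write q = alpha ^ 2 and let Z be the heat trace of P.  The Dirichlet
   eigenspace of the disjoint union is the direct sum of those of the pieces,
   and a similarity of ratio r divides eigenvalues by r ^ 2, so the heat trace
   of P_alpha at t is the sum over j >= 0 of Z (t / q ^ j); it converges by the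
   spectral gap of P (Poincare inequality), which also leaves only finitely many
   pieces below any given energy.
   Put G s = Z s - A / (4 pi s) + L / (8 sqrt (pi s)) and F = G - V, so that F s
   is exponentially small as s tends to 0.  The geometric series of the A and L
   terms give the first two terms of the expansion.  With
     p (ln t) = sum_(j >= 0) G (t / q ^ j) + sum_(j >= 1) F (t * q ^ j) - c ln t,
   replacing t by t / q moves one term from the first sum to the second one,
   i.e. adds F t - G t = - V, and this is exactly what c ln t compensates; the
   error of the expansion is the second sum, dominated by its term j = 1. *)

Require Import Defs.
From HB Require Import structures.
From mathcomp Require Import all_boot all_order all_algebra.
From mathcomp Require Import all_classical all_reals all_analysis.
From mathcomp Require Import measurable_realfun ring lra.
Set Implicit Arguments.
Unset Strict Implicit.
Unset Printing Implicit Defensive.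
Import Order.TTheory GRing.Theory Num.Theory.
Import numFieldNormedType.Exports.
Local Open Scope classical_set_scope.
Local Open Scope ring_scope.

(** * Lebesgue measure of the plane under similarities *)

(** Multiplicities are treated as extended natural numbers, and the heat trace is rewritten as an
    integral of a counting function that is linear in them. Spectra of pieces are then merged by
    adding multiplicities level by level, and the sorted eigenvalues appear only in the link between
    counting function and heat trace. The infinite direct sum is reduced to unions of two sets. At a
    fixed level [nu] the gap [c / q ^ j] of piece [j] exceeds [nu] from some [k] on; the tail of the
    pieces from [k] on, taken as a single open set, then carries no eigenfunction at that level, and
    additivity for two disjoint open sets is iterated [k] times. The maps [T j] are given only as
    distance preserving. Their affine form is derived, so that composition with them acts on
    derivatives by explicit formulas and on area by a constant factor. Neighbouring pieces may
    touch. A test function on a union still splits smoothly, because its support lies in the open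
    union and so avoids the common boundary. The geometric bounds rest on [exp (- x) <= 1 / x],
    which turns an exponential in [q ^- j] into a multiple of [q ^ j]. *)

Section PlaneMeasure.
Context {R : realType}.
Implicit Types (A : set (plane R)) (phi : plane R -> R).
Local Notation mplane := (measurableTypeR R * measurableTypeR R)%type.
Local Notation leb := (@lebesgue_measure R).

Lemma continuous_fst_plane : continuous (fun x : plane R => x.1).
Proof. by move=> [a b]; apply: (@cvg_fst _ _ (nbhs a) (nbhs b)). Qed.

Lemma continuous_snd_plane : continuous (fun x : plane R => x.2).
Proof. by move=> [a b]; apply: (@cvg_snd _ _ (nbhs a) (nbhs b)). Qed.

(** The plane carries the product sigma-algebra, so an open set is written as a countable union of
    rectangles: the squares with rational centre and half-width that it contains, enumerated by
    [unpickle]. *)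
Lemma open_measurable_plane A : open A -> measurable (A : set mplane).
Proof.
move=> oA.
pose B (q : rat * rat * rat) : set (plane R) :=
  `]ratr q.1.1 - ratr q.2, ratr q.1.1 + ratr q.2[ `*`
  `]ratr q.1.2 - ratr q.2, ratr q.1.2 + ratr q.2[.
have -> : A = \bigcup_(n in [set: nat])
   (if @unpickle (rat * rat * rat)%type n is Some q then
     (if `[< B q `<=` A >] then B q else set0) else set0).
  apply/seteqP; split => [[x y] Axy|x [n _]]; last first.
    by case: unpickle => // q; case: asboolP => // + ?; exact.
  have /nbhs_ballP[e /= e0 eA] : nbhs (x, y) A by exact: open_nbhs_nbhs.
  have e4 : 0 < e / 4 by rewrite divr_gt0.
  (* The half-width lies between [e / 4] and [e / 2] and the centre is within [e / 4] of [(x, y)] in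
     each coordinate, so the square contains [(x, y)] and stays within [3 e / 4] of it. *)
  have [r] := rat_in_itvoo (ltr_pwDr e4 (lexx (e / 4))).
  rewrite in_itv/= => /andP[r1 r2].
  have [p] := rat_in_itvoo (ltr_pwDr e4 (lexx x)).
  have [q] := rat_in_itvoo (ltr_pwDr e4 (lexx y)).
  rewrite !in_itv/= => /andP[q1 q2] /andP[p1 p2].
  exists (pickle (p, q, r)); first exact: I.
  rewrite pickleK.
  case: asboolP => [_|[]].
    by split; rewrite /= in_itv/=; apply/andP; split; lra.
  move=> [u v] [/=]; rewrite !in_itv/= => /andP[u1 u2] /andP[v1 v2].
  by apply: eA; split; rewrite /ball/= ltr_norml; apply/andP; split; lra.
apply: bigcupT_measurable => n; case: unpickle => // q.
by case: ifP => // _; apply: measurableX.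
Qed.

Lemma continuous_measurable_plane phi : continuous phi ->
  measurable_fun [set: mplane] (phi : mplane -> measurableTypeR R).
Proof.
move=> /continuousP cf; apply: (measurability _ (RGenOpens.measurableE R)).
move=> _ [_ [a [b ->] <-]]; rewrite setTI; apply: open_measurable_plane.
by apply: cf; exact: interval_open.
Qed.

(** By uniqueness of Lebesgue measure: [|c|] times the pushforward agrees with [leb] on the
    intervals []a, b]]. The sign of [c] decides which end of the preimage is closed. *)
Lemma lebesgue_measure_affine (c d : R) (A : set R) : c != 0 -> measurable A ->
  leb ((fun y => c * y + d) @^-1` A) = (`|c|^-1%:E * leb A)%E.
Proof.
move=> c0 mA.
have mf : measurable_fun [set: measurableTypeR R]
    ((fun y => c * y + d) : measurableTypeR R -> measurableTypeR R).
  apply: continuous_measurable_fun => y; apply: continuousD; last exact: cvg_cst.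
  by apply: continuousM; [exact: cvg_cst|exact: cvg_id].
have cp : 0 < `|c| by rewrite normr_gt0.
pose m : {measure set (measurableTypeR R) -> \bar R} :=
  mscale (NngNum (normr_ge0 c)) (pushforward leb
    ((fun y => c * y + d) : measurableTypeR R -> measurableTypeR R)).
suff -> : leb A = m mf A.
  rewrite /m /mscale /= /pushforward muleA -EFinM mulVf ?mul1e//.
  by rewrite normr_eq0.
apply: lebesgue_measure_unique => // _ [[a b]] _ <-.
rewrite /m /mscale /= /pushforward /=.
change (leb `]a, b]%classic = (`|c|%:E * leb ((fun y : R => (c * y + d)%R) @^-1` `]a, b]%classic))%E).
have := c0; rewrite neq_lt => /orP[c_lt|c_gt].
- have -> : (fun y => c * y + d) @^-1` `]a, b]%classic = `[(b - d) / c, (a - d) / c[%classic.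
    apply/seteqP; split => y /=; rewrite !in_itv/= ler_ndivrMr// ltr_ndivlMr//;
      by move=> /andP[? ?]; apply/andP; split; lra.
  rewrite !lebesgue_measure_itv/= !lte_fin ltr_ndivlMr// divfK// ltrD2r.
  case: ltP => _; last by rewrite mule0.
  by rewrite -!EFinB -EFinM ltr0_norm//; congr EFin; field.
- have -> : (fun y => c * y + d) @^-1` `]a, b]%classic = `](a - d) / c, (b - d) / c]%classic.
    apply/seteqP; split => y /=; rewrite !in_itv/= ltr_pdivrMr// ler_pdivlMr//;
      by move=> /andP[? ?]; apply/andP; split; lra.
  rewrite !lebesgue_measure_itv/= !lte_fin ltr_pdivrMr// divfK// ltrD2r.
  case: ltP => _; last by rewrite mule0.
  by rewrite -!EFinB -EFinM gtr0_norm//; congr EFin; field.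
Qed.

(** The factor [k] belongs to preimages, so it is the inverse of the absolute Jacobian determinant.
    For similarities only its existence is recorded, since it cancels from the two sides of the weak
    eigenvalue equation. *)
Definition measure_scaling (S : plane R -> plane R) (k : R) : Prop :=
  [/\ 0 < k, measurable_fun [set: mplane] (S : mplane -> mplane) &
      forall A : set mplane, measurable A -> leb2 R (S @^-1` A) = (k%:E * leb2 R A)%E].

Lemma measure_scaling_comp S1 S2 k1 k2 : measure_scaling S1 k1 ->
  measure_scaling S2 k2 -> measure_scaling (S1 \o S2) (k1 * k2).
Proof.
move=> [k1p m1 e1] [k2p m2 e2]; split; first exact: mulr_gt0.
  exact: measurableT_comp.
move=> A mA; rewrite comp_preimage e2; last by rewrite -[X in measurable X]setTI; exact: m1.
by rewrite e1// muleA -EFinM mulrC.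
Qed.

Lemma continuous_measurable_plane2 (S : plane R -> plane R) :
  continuous S -> measurable_fun [set: mplane] (S : mplane -> mplane).
Proof.
move=> cS; apply/measurable_fun_pairP; split.
- apply: (@continuous_measurable_plane (fun x => (S x).1)) => x.
  apply: (@continuous_comp _ _ _ S (fun x => x.1)); first exact: cS.
  exact: continuous_fst_plane.
- apply: (@continuous_measurable_plane (fun x => (S x).2)) => x.
  apply: (@continuous_comp _ _ _ S (fun x => x.2)); first exact: cS.
  exact: continuous_snd_plane.
Qed.

Lemma measure_scaling_swap : measure_scaling (fun x => (x.2, x.1)) 1.
Proof.
have mS : measurable_fun [set: mplane] ((fun x => (x.2, x.1)) : mplane -> mplane).
  by apply/measurable_fun_pairP; split; [exact: measurable_snd|exact: measurable_fst].
split => // A mA; rewrite mul1e.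
pose m : {measure set mplane -> \bar R} :=
  (pushforward (leb2 R) ((fun x => (x.2, x.1)) : mplane -> mplane)).
apply/esym/(@product_measure_unique _ _ _ _ _ _ _ (m mS)) => // X Y mX mY.
rewrite /m /= /pushforward.
have -> : (fun x : mplane => (x.2, x.1)) @^-1` (X `*` Y) = Y `*` X.
  by apply/seteqP; split => -[? ?] [].
by rewrite product_measure1E// muleC.
Qed.

(** The map sends each vertical line to itself by an affine map of slope [c], so the factor comes
    out of the integral over the vertical sections. *)
Lemma measure_scaling_shear (a c d : R) : c != 0 ->
  measure_scaling (fun x => (x.1, a * x.1 + c * x.2 + d)) `|c|^-1.
Proof.
move=> c0; split; first by rewrite invr_gt0 normr_gt0.
  apply: continuous_measurable_plane2 => x.
  apply: (@cvg_pair _ _ _ _ (nbhs x.1) (nbhs _)); first exact: continuous_fst_plane.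
  apply: cvgD; last exact: cvg_cst.
  apply: cvgD; (apply: cvgM; first exact: cvg_cst).
    exact: continuous_fst_plane.
  exact: continuous_snd_plane.
move=> A mA /=; rewrite /product_measure1 /=.
transitivity (\int[leb]_x (`|c|^-1%:E * (leb \o xsection A) x))%E.
  apply: eq_integral => x _ /=.
  rewrite -(lebesgue_measure_affine (a * x + d) c0); last exact: measurable_xsection.
  congr (leb _); apply/seteqP; split => y; rewrite /xsection/= !inE/=;
    by rewrite (_ : a * x + c * y + d = c * y + (a * x + d))//; ring.
rewrite ge0_integralZl//; last exact: measurable_fun_xsection.
Qed.
End PlaneMeasure.

(** * Similarities of the plane: affine form and effect on area *)

Section Similarity.
Context {R : realType}.
Local Notation mplane := (measurableTypeR R * measurableTypeR R)%type.

(* The linear part is the matrix with columns (a, b) and e (- b, a); e = 1 or -1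
   tells whether the orientation is preserved. *)
Definition similarity_map (a b e p q : R) (x : plane R) : plane R :=
  (a * x.1 - e * b * x.2 + p, b * x.1 + e * a * x.2 + q).

(** [k] is the square of the ratio, that is, the factor that acts on eigenvalues. *)
Definition similarity (S : plane R -> plane R) (k : R) : Prop :=
  0 < k /\ exists a b e p q, [/\ e ^+ 2 = 1, a ^+ 2 + b ^+ 2 = k &
    S = similarity_map a b e p q].

(* The product measure is only accessible through its sections, so the map is
   factored into vertical shears and coordinate swaps; the case a = 0 needs its
   own factorisation. *)
Lemma similarity_measure_scaling S k : similarity S k ->
  exists k', measure_scaling S k'.
Proof.
move=> [k0 [a [b [e [p [q [e1 abk ->]]]]]]].
have e0 : e != 0 by apply: contra_eq_neq e1 => ->; rewrite expr0n/= eq_sym oner_eq0.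
have [a0|a0] := eqVneq a 0.
  have b0 : b != 0.
    by apply/eqP => b0; move: k0; rewrite -abk a0 b0 !expr0n/= addr0 ltxx.
  have eb0 : - e * b != 0 by rewrite mulf_neq0// oppr_eq0.
  have := measure_scaling_comp (measure_scaling_shear 0 q b0)
    (measure_scaling_comp (measure_scaling_swap (R := R)) (measure_scaling_shear 0 p eb0)).
  set k' := (X in measure_scaling _ X); set S' := (X in measure_scaling X _).
  move=> h; exists k'; suff <- : S' = similarity_map a b e p q by [].
  apply/funext => -[x y]; rewrite /S' /similarity_map /= a0; congr pair; ring.
(* A shear conjugated by the swap produces the new first coordinate; the second one is then [b / a]
   times the new first coordinate plus [e * k / a] times the old second one, where [e * k] is the
   determinant. *)
have ea0 : e * k / a != 0 by rewrite !mulf_neq0 ?invr_eq0// gt_eqF.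
have W := measure_scaling_swap (R := R).
have h1 := measure_scaling_comp W (measure_scaling_comp (measure_scaling_shear (- e * b) p a0) W).
have := measure_scaling_comp (measure_scaling_shear (b / a) (q - b * p / a) ea0) h1.
set k' := (X in measure_scaling _ X); set S' := (X in measure_scaling X _).
move=> h; exists k'; suff <- : S' = similarity_map a b e p q by [].
by apply/funext => -[x y]; rewrite /S' /similarity_map /= -abk; congr pair; field.
Qed.

Lemma similarity_inv S k : similarity S k ->
  exists S', [/\ similarity S' k^-1, cancel S S' & cancel S' S].
Proof.
move=> [k0 [a [b [e [p [q [e1 abk ->]]]]]]].
have kn0 : k != 0 by rewrite gt_eqF.
have abn0 : a ^+ 2 + b ^+ 2 != 0 by rewrite abk.
exists (similarity_map (a / k) (- e * b / k) e (- (a * p + b * q) / k)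
  (- (e * (a * q - b * p)) / k)); split.
- split; first by rewrite invr_gt0.
  do 5 eexists; split; [exact: e1| |reflexivity].
  rewrite !expr_div_n exprMn sqrrN e1 mul1r -mulrDl abk expr2.
  by field.
- move: e1 => /eqP; rewrite sqrf_eq1 => /pred2P[] -> [x y];
    by rewrite /similarity_map /= -abk; congr pair; field.
- move: e1 => /eqP; rewrite sqrf_eq1 => /pred2P[] -> [x y];
    by rewrite /similarity_map /= -abk; congr pair; field.
Qed.

Lemma dot_sqr_ge0 (u : plane R) : 0 <= dot u u.
Proof. by rewrite /dot addr_ge0// -expr2 sqr_ge0. Qed.

(** The images of the origin and of the two unit vectors form an orthonormal frame, and the
    distances from [T u] to these three points determine its coordinates in that frame by
    polarisation. This forces [T] to be affine. *)
Lemma isometry_similarity T r : euclidean_isometry T -> 0 < r ->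
  similarity (fun x => T (r *: x)) (r ^+ 2).
Proof.
move=> hT r0; split; first exact: exprn_gt0.
pose p := (T 0).1; pose q := (T 0).2.
have D u w : dot (T u - T w) (T u - T w) = dot (u - w) (u - w).
  have := hT u w; rewrite /edist /enorm => /(congr1 (fun z => z ^+ 2)).
  by rewrite !sqr_sqrtr// dot_sqr_ge0.
pose a := (T (1, 0)).1 - p; pose b := (T (1, 0)).2 - q.
pose c := (T (0, 1)).1 - p; pose d := (T (0, 1)).2 - q.
have := D (1, 0) 0; have := D (0, 1) 0; have := D (1, 0) (0, 1).
rewrite /dot /= -/p -/q -/a -/b -/c -/d => h1 h2 h3.
have e1 : a ^+ 2 + b ^+ 2 = 1 by rewrite !expr2; lra.
have e2 : c ^+ 2 + d ^+ 2 = 1 by rewrite !expr2; lra.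
have e3 : a * c + b * d = 0.
  have : (a - c) ^+ 2 + (b - d) ^+ 2 = 2.
    by rewrite /a /b /c /d !expr2; lra.
  by rewrite !expr2 in e1 e2 *; lra.
(* The determinant of the frame; orthonormality makes it a square root of [1] and expresses the
   second column through the first. *)
pose e := a * d - b * c.
have dE : d = e * a.
  transitivity ((a ^+ 2 + b ^+ 2) * d - b * (a * c + b * d)); first by rewrite e1 e3; ring.
  by rewrite /e; ring.
have cE : c = - e * b.
  transitivity ((a ^+ 2 + b ^+ 2) * c - a * (a * c + b * d)); first by rewrite e1 e3; ring.
  by rewrite /e; ring.
have ee : e ^+ 2 = 1.
  transitivity (e ^+ 2 * (a ^+ 2 + b ^+ 2)); first by rewrite e1 mulr1.
  by rewrite -e2 dE cE; ring.
suff E u : T u = (a * u.1 - e * b * u.2 + p, b * u.1 + e * a * u.2 + q).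
  exists (r * a), (r * b), e, p, q; split => //.
    by rewrite !exprMn -mulrDr e1 mulr1.
  by apply/funext => x; rewrite E /similarity_map /= /GRing.scale/=; congr pair; ring.
have := D u 0; have := D u (1, 0); have := D u (0, 1).
rewrite /dot /= -/p -/q => k1 k2 k3; rewrite ?subr0 in k3.
pose X := (T u).1 - p; pose Y := (T u).2 - q.
have k3' : X ^+ 2 + Y ^+ 2 = u.1 ^+ 2 + u.2 ^+ 2 by rewrite !expr2 /X /Y; lra.
have k2' : a * X + b * Y = u.1.
  have : (X - a) ^+ 2 + (Y - b) ^+ 2 = (u.1 - 1) ^+ 2 + u.2 ^+ 2.
    by rewrite !expr2 /X /Y /a /b; lra.
  by rewrite !expr2 in k3' e1 *; lra.
have k1' : c * X + d * Y = u.2.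
  have : (X - c) ^+ 2 + (Y - d) ^+ 2 = u.1 ^+ 2 + (u.2 - 1) ^+ 2.
    by rewrite !expr2 /X /Y /c /d; lra.
  by rewrite !expr2 in k3' e2 *; lra.
have XE : X = a * u.1 - e * b * u.2.
  rewrite -k2' -k1' cE dE; transitivity ((a ^+ 2 + e ^+ 2 * b ^+ 2) * X + (1 - e ^+ 2) * a * b * Y).
    by rewrite ee mul1r e1; ring.
  by ring.
have YE : Y = b * u.1 + e * a * u.2.
  rewrite -k2' -k1' cE dE; transitivity ((b ^+ 2 + e ^+ 2 * a ^+ 2) * Y + (1 - e ^+ 2) * a * b * X).
    by rewrite ee mul1r (addrC (b ^+ 2)) e1; ring.
  by ring.
rewrite [LHS]surjective_pairing; congr pair.
  by rewrite -[LHS](subrK p) -/X XE.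
by rewrite -[LHS](subrK q) -/Y YE.
Qed.

End Similarity.

(** * Partial derivatives and test functions *)

Section Calculus.
Context {R : realType}.
Implicit Types (phi psi : plane R -> R) (s : seq bool).

Lemma near_eq_differentiable phi psi x :
  (\forall y \near x, phi y = psi y) -> differentiable phi x -> differentiable psi x.
Proof.
move=> e dphi; have [cd /eqaddoP H] := (diff_locallyP _ _).1 dphi.
have xe : phi x = psi x by exact: nbhs_singleton e.
have e' : \forall h \near (0 : plane R), phi (h + x) = psi (h + x).
  have : (h + x) @[h --> (0 : plane R)] --> x.
    by rewrite -[X in _ --> X]add0r; apply: cvgD; [exact: cvg_id|exact: cvg_cst].
  by move/(_ _ e).
suff E : 'd psi x = 'd phi x :> (plane R -> R).
  apply/diff_locallyP; rewrite E; split => //.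
  apply/eqaddoP => eps eps0; near=> h.
  have -> : (psi \o shift x - (cst (psi x) + 'd phi x)) h =
      (phi \o shift x - (cst (phi x) + 'd phi x)) h.
    by rewrite !fctE/= -xe; congr (_ - _); apply/esym; near: h.
  by near: h; apply: H.
apply: diff_unique => //; apply/eqaddoP => eps eps0; near=> h.
have -> : (psi \o shift x - (cst (psi x) + 'd phi x)) h =
      (phi \o shift x - (cst (phi x) + 'd phi x)) h.
    by rewrite !fctE/= -xe; congr (_ - _); apply/esym; near: h.
  by near: h; apply: H.
Unshelve. all: by end_near. Qed.

Lemma near_eq_partial phi psi i x :
  (\forall y \near x, phi y = psi y) -> partial i phi x = partial i psi x.
Proof. exact: near_eq_derive. Qed.

Lemma differentiable_lin (c d : R) phi psi x : differentiable phi x ->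
  differentiable psi x -> differentiable (fun x => c * phi x + d * psi x) x.
Proof.
move=> dp dq.
by apply: (@differentiableD _ _ _ (c \*: phi) (d \*: psi)); apply: differentiableZ.
Qed.

Lemma partial_lin i (c d : R) phi psi x : differentiable phi x ->
  differentiable psi x -> partial i (fun x => c * phi x + d * psi x) x =
  c * partial i phi x + d * partial i psi x.
Proof.
move=> dp dq; rewrite /partial; set v := if i then _ else _.
have := @deriveD _ _ _ (c \*: phi) (d \*: psi) x v.
rewrite !deriveZ; do ?exact: diff_derivable.
by apply; apply: derivableZ; exact: diff_derivable.
Qed.

Section Sim.
Variables a b e p q : R.
Let S := similarity_map a b e p q.

Lemma differentiable_similarity x : differentiable S x.
Proof.
have d1 : differentiable (fun x : plane R => x.1) x.
  by apply: (@linear_differentiable _ _ _ (fst : {linear (R * R)%type -> R}));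
    exact: continuous_fst_plane.
have d2 : differentiable (fun x : plane R => x.2) x.
  by apply: (@linear_differentiable _ _ _ (snd : {linear (R * R)%type -> R}));
    exact: continuous_snd_plane.
have h (c d k : R) : differentiable (fun x : plane R => c * x.1 + d * x.2 + k) x.
  apply: (@differentiableD _ _ _ (fun x : plane R => c * x.1 + d * x.2) (cst k)) => //.
  exact: differentiable_lin.
apply: (@differentiable_pair _ _ _ _ (fun x => a * x.1 - e * b * x.2 + p)
   (fun x => b * x.1 + e * a * x.2 + q)) => //.
by have := h a (- (e * b)) p; under eq_fun do rewrite mulNr.
Qed.

Lemma differentiable_comp_similarity phi x :
  differentiable phi (S x) -> differentiable (phi \o S) x.
Proof. by apply: differentiable_comp; exact: differentiable_similarity. Qed.

(** Since [S] is affine, the difference quotient of [phi \o S] in direction [v] is the one of [phi]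
    at [S x] in the image direction [w], for every step; only the linearity of the differential of
    [phi] remains to be used. *)
Lemma derive_comp_similarity phi x (v : plane R) : differentiable phi (S x) ->
  'D_v (phi \o S) x = (a * v.1 - e * b * v.2) * partial false phi (S x) +
                      (b * v.1 + e * a * v.2) * partial true phi (S x).
Proof.
move=> dphi; rewrite /partial.
pose w : plane R := (a * v.1 - e * b * v.2, b * v.1 + e * a * v.2).
transitivity ('D_w phi (S x)).
  rewrite /derive; set f1 := (X in lim (X @ _)); set f2 := (X in _ = lim (X @ _)).
  suff -> : f1 = f2 by [].
  apply/funext => h; rewrite /f1 /f2 /=; congr (_ *: (phi _ - _)).
  rewrite /S /similarity_map /w; congr pair => /=; rewrite /GRing.scale/=; ring.
have -> : w = w.1 *: (1, 0) + w.2 *: (0, 1) :> plane R.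
  by rewrite [LHS]surjective_pairing; congr pair; rewrite /= /GRing.scale/=; ring.
by rewrite !deriveE// [LHS]linearD; congr (_ + _); exact: linearZ.
Qed.

Lemma partial_comp_similarity i phi x : differentiable phi (S x) ->
  partial i (phi \o S) x =
  (if i then - (e * b) else a) * partial false phi (S x) +
  (if i then e * a else b) * partial true phi (S x).
Proof.
move=> dphi; rewrite {1}/partial derive_comp_similarity//; case: i => /=; ring.
Qed.
End Sim.

Lemma smoothW phi x : smooth phi -> differentiable phi x.
Proof. exact: (fun h => h [::] x). Qed.

Lemma smooth_partial i phi : smooth phi -> smooth (partial i phi).
Proof. by move=> h s x; have := h (rcons s i) x; rewrite foldr_rcons. Qed.

(* Differentiability is only required below the order at hand, since this is used
   in the induction proving that phi \o S is smooth. *)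
Lemma foldr_partial_lin (c d : R) phi psi s :
  (forall s' x, (size s' < size s)%N -> differentiable (foldr partial phi s') x) ->
  (forall s' x, (size s' < size s)%N -> differentiable (foldr partial psi s') x) ->
  foldr partial (fun x => c * phi x + d * psi x) s =
  (fun x => c * foldr partial phi s x + d * foldr partial psi s x).
Proof.
elim: s => [//|i s IH] h1 h2 /=; rewrite IH; last 2 first.
- by move=> s' x hs; apply: h1; rewrite /= ltnS ltnW.
- by move=> s' x hs; apply: h2; rewrite /= ltnS ltnW.
by apply/funext => x; rewrite partial_lin//; [exact: h1|exact: h2].
Qed.

(** Induction on the number of derivatives, for all [phi] at once: peeling off the innermost one
    turns [phi \o S] into a linear combination of the functions [partial j phi \o S], with one
    derivative fewer to apply. *)
Lemma smooth_comp_similarity phi a b e p q : smooth phi ->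
  smooth (phi \o similarity_map a b e p q).
Proof.
move=> sphi s; have [n] := ubnP (size s); elim: n => // n IH in s phi sphi *.
case/lastP: s => [_ x|s i]; first exact/differentiable_comp_similarity/smoothW.
rewrite size_rcons ltnS => sn x; rewrite foldr_rcons.
have -> : partial i (phi \o similarity_map a b e p q) = (fun x =>
   (if i then - (e * b) else a) * (partial false phi \o similarity_map a b e p q) x +
   (if i then e * a else b) * (partial true phi \o similarity_map a b e p q) x).
  by apply/funext => y; rewrite partial_comp_similarity//; exact: smoothW.
rewrite foldr_partial_lin; last 2 first.
- by move=> s' y hs; apply: IH; [exact: smooth_partial|exact: ltn_trans sn].
- by move=> s' y hs; apply: IH; [exact: smooth_partial|exact: ltn_trans sn].
by apply: differentiable_lin; apply: IH => //; exact: smooth_partial.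
Qed.

Definition restrict (A : set (plane R)) phi : plane R -> R :=
  fun x => \1_A x * phi x.

Lemma differentiable_restrict A phi x :
  (\forall y \near x, A y) \/ (\forall y \near x, ~ A y) \/
     (\forall y \near x, phi y = 0) ->
  differentiable phi x -> differentiable (restrict A phi) x.
Proof.
move=> + dphi => -[h|[h|h]].
- apply: near_eq_differentiable dphi; near=> y; rewrite /restrict indicE mem_set ?mul1r//.
  by near: y.
- apply: (@near_eq_differentiable (cst 0)) => //; near=> y.
  by rewrite /restrict indicE memNset ?mul0r//; near: y.
- apply: (@near_eq_differentiable (cst 0)) => //; near=> y.
  by rewrite /restrict (near h y) ?mulr0.
Unshelve. all: by end_near. Qed.

Lemma partial_restrict A phi i x :
  (\forall y \near x, A y) \/ (\forall y \near x, ~ A y) \/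
     (\forall y \near x, phi y = 0) ->
  partial i (restrict A phi) x = restrict A (partial i phi) x.
Proof.
have p0 : partial i (cst 0) x = 0 :> R by exact: derive_cst.
case=> [h|[h|h]].
- rewrite {2}/restrict indicE mem_set ?mul1r; last exact: nbhs_singleton h.
  apply: near_eq_partial; near=> y; rewrite /restrict indicE mem_set ?mul1r//.
  by near: y.
- rewrite {2}/restrict indicE memNset ?mul0r; last exact: nbhs_singleton h.
  rewrite -[RHS]p0; apply: near_eq_partial; near=> y.
  by rewrite /restrict indicE memNset ?mul0r//; near: y.
- rewrite {2}/restrict (_ : partial i phi x = 0).
    rewrite mulr0 -[RHS]p0; apply: near_eq_partial; near=> y.
    by rewrite /restrict (near h y) ?mulr0.
  by rewrite -[RHS]p0; exact: near_eq_partial.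
Unshelve. all: by end_near. Qed.

(* Under this condition multiplying phi by the indicator of A preserves
   smoothness. *)
Definition splits (A : set (plane R)) phi := forall x : plane R,
  (\forall y \near x, A y) \/ (\forall y \near x, ~ A y) \/
     (\forall y \near x, phi y = 0).

Lemma splits_partial A phi i : splits A phi -> splits A (partial i phi).
Proof.
move=> h x; have [?|[?|hx]] := h x; [by left|by right; left|right; right].
have hx' := nbhs_interior hx.
near=> y.
have p0 : partial i (cst 0) y = 0 :> R by exact: derive_cst.
rewrite -[RHS]p0; apply: near_eq_partial.
by near: y.
Unshelve. all: by end_near. Qed.

Lemma smooth_restrict A phi : splits A phi -> smooth phi -> smooth (restrict A phi).
Proof.
move=> h sphi s x; suff [E h'] : foldr partial (restrict A phi) s =
    restrict A (foldr partial phi s) /\ splits A (foldr partial phi s).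
  by rewrite E; apply: differentiable_restrict => //; exact: sphi.
elim: s => [//|i s [E h']] /=; split; last exact: splits_partial.
by rewrite E; apply/funext => y; exact: partial_restrict.
Qed.

End Calculus.

(** * Test functions: square integrability, restriction to a piece, composition with similarities *)

Section TestFunctions.
Context {R : realType}.
Implicit Types (phi psi : plane R -> R) (A B M : set (plane R)).
Local Notation mplane := (measurableTypeR R * measurableTypeR R)%type.

Lemma test_function_continuous M phi : test_function M phi -> continuous phi.
Proof. by move=> [s _ _] x; apply/differentiable_continuous/smoothW. Qed.

Lemma test_function_partial_continuous M phi i :
  test_function M phi -> continuous (partial i phi).
Proof. by move=> [s _ _] x; apply/differentiable_continuous/smoothW/smooth_partial. Qed.

Lemma test_functionW M M' phi : M `<=` M' -> test_function M phi -> test_function M' phi.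
Proof. by move=> MM' [s c h]; split => // x /h /MM'. Qed.

Lemma notin_support_near phi x : ~ closure [set x | phi x != 0] x ->
  \forall y \near x, phi y = 0.
Proof.
move=> h; have : (~` closure [set x | phi x != 0]) x by [].
rewrite -interiorC => hx; apply: filterS hx => y /=.
by move=> /negP; rewrite negbK => /eqP.
Qed.

Lemma partial_eq0 phi i x : ~ closure [set x | phi x != 0] x -> partial i phi x = 0.
Proof.
have p0 : partial i (cst 0) x = 0 :> R by exact: derive_cst.
by move=> /notin_support_near h; rewrite -[RHS]p0; exact: near_eq_partial.
Qed.

Lemma test_function_eq0 M phi x : test_function M phi -> ~ M x -> phi x = 0.
Proof.
move=> [_ _ h] nMx; apply/eqP/negPn/negP => hx.
by apply: nMx; apply: h; exact: subset_closure.
Qed.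

Lemma test_function_partial_eq0 M phi i x :
  test_function M phi -> ~ M x -> partial i phi x = 0.
Proof. by move=> [_ _ h] nMx; apply: partial_eq0 => /h. Qed.

Lemma compact_square_bound (K : set (plane R)) : compact K ->
  exists2 B : R, 0 < B & forall x, K x -> `|x.1| <= B /\ `|x.2| <= B.
Proof.
move=> /compact_bounded[B [_ hB]]; exists (`|B| + 1); first by rewrite ltr_wpDl.
move=> x /(hB (`|B| + 1)); rewrite (ltr_pwDr ltr01 (ler_norm B)) => /(_ isT) /=.
by rewrite prod_normE ge_max => /andP[].
Qed.

Lemma compact_support_integrable_sqr (K : set (plane R)) phi : compact K ->
  continuous phi -> (forall x, ~ K x -> phi x = 0) ->
  (leb2 R).-integrable [set: mplane] (fun x => ((phi x) ^+ 2)%:E).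
Proof.
move=> cK cphi h0.
have [B B0 hB] := compact_square_bound cK.
have [C [_ hC]] : bounded_set (phi @` K).
  by apply/compact_bounded/continuous_compact => //; exact: continuous_subspaceT.
pose Q : set mplane := `[- B, B] `*` `[- B, B].
have mQ : measurable Q by exact: measurableX.
have mphi := continuous_measurable_plane cphi.
apply: (@le_integrable _ _ _ _ _ measurableT _
   (fun x => ((`|C| + 1) ^+ 2 * \1_Q x)%:E)).
- by apply/measurable_EFinP; apply: measurable_funX.
- move=> x _; rewrite lee_fin [leRHS]ger0_norm; last by rewrite mulr_ge0// sqr_ge0.
  rewrite ger0_norm ?sqr_ge0//.
  have [Kx|nKx] := pselect (K x); last by rewrite h0// expr0n mulr_ge0// sqr_ge0.
  have Qx : Q x by have [? ?] := hB _ Kx; split; rewrite /= in_itv/= -ler_norml.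
  rewrite indicE mem_set// mulr1 -[leLHS]real_normK ?num_real//.
  rewrite lerXn2r ?nnegrE//; apply: (hC (`|C| + 1)); last by exists x.
  exact: (ltr_pwDr ltr01 (ler_norm C)).
- apply: (@eq_integrable _ _ _ _ _ measurableT
     (fun x => ((`|C| + 1) ^+ 2)%:E * (\1_Q x)%:E)%E); first by move=> x _; rewrite EFinM.
  apply: integrableZl => //; apply/integrableP; split; first exact/measurable_EFinP.
  rewrite (eq_integral (fun x => (\1_Q x)%:E)); last first.
    by move=> t _; rewrite gee0_abs// lee_fin.
  rewrite integral_indic// setIT.
  apply: (@le_lt_trans _ _ (leb2 R Q)); first exact: lexx.
  have -> : leb2 R Q = (lebesgue_measure (`[(- B)%R, B]%classic : set R) *
      lebesgue_measure (`[(- B)%R, B]%classic : set R))%E.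
    exact: product_measure1E.
  rewrite lebesgue_measure_itv/= lte_fin gtrN//.
  by rewrite -EFinB -EFinM ltry.
Qed.

Lemma test_function_integrable_sqr M phi : test_function M phi ->
  (leb2 R).-integrable [set: mplane] (fun x => ((phi x) ^+ 2)%:E).
Proof.
move=> tphi; have [s c h] := tphi; apply: (compact_support_integrable_sqr c).
  exact: test_function_continuous tphi.
move=> x nx; apply/eqP/negPn/negP => hx; apply: nx; exact: subset_closure.
Qed.

Lemma test_function_partial_integrable_sqr M phi i : test_function M phi ->
  (leb2 R).-integrable [set: mplane] (fun x => ((partial i phi x) ^+ 2)%:E).
Proof.
move=> tphi; have [s c h] := tphi; apply: (compact_support_integrable_sqr c).
  exact: test_function_partial_continuous tphi.
by move=> x; exact: partial_eq0.
Qed.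

(** A point of the support lies in [A] or in [B], and openness with disjointness gives one of the
    first two alternatives; off the support [phi] vanishes nearby. Common boundary points of [A] and
    [B] are of the last kind. *)
Lemma test_function_splits A B phi : open A -> open B -> A `&` B = set0 ->
  test_function (A `|` B) phi -> splits A phi.
Proof.
move=> oA oB AB0 [_ _ h] x.
have [/h[Ax|Bx]|nx] := pselect (closure [set x | phi x != 0] x).
- by left; exact: open_nbhs_nbhs.
- right; left; have : nbhs x B by exact: open_nbhs_nbhs.
  apply: filterS => y By Ay.
  by have : (A `&` B) y by []; rewrite AB0.
- by right; right; exact: notin_support_near.
Qed.

Lemma test_function_restrict A B phi : open A -> open B -> A `&` B = set0 ->
  test_function (A `|` B) phi -> test_function A (restrict A phi) /\
  forall i, partial i (restrict A phi) = restrict A (partial i phi).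
Proof.
move=> oA oB AB0 tphi; have hs := test_function_splits oA oB AB0 tphi.
have [s c h] := tphi; split; last first.
  by move=> i; apply/funext => x; exact: partial_restrict.
have sub : closure [set x | restrict A phi x != 0] `<=` closure [set x | phi x != 0].
  apply: closure_subset => x /=; apply: contra => /eqP p0.
  by rewrite /restrict p0 mulr0.
split; first exact: smooth_restrict.
  by apply: subclosed_compact c sub; exact: closed_closure.
move=> x cx; have [//|Bx] := h _ (sub _ cx).
(* A support point of the restriction lying in [B] would have points of [B] nearby where the
   restriction is nonzero, yet it vanishes on [B]. *)
have /cx[y [/= + By]] : nbhs x B by exact: open_nbhs_nbhs.
rewrite /restrict indicE; case: (boolP (y \in A)) => [|_]; last by rewrite mul0r eqxx.
rewrite inE => Ay _; have : (A `&` B) y by [].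
by rewrite AB0.
Qed.

Lemma similarity_continuous S k : similarity S k -> continuous (S : plane R -> plane R).
Proof.
move=> [_ [a [b [e [p [q [_ _ ->]]]]]]] x.
exact/differentiable_continuous/differentiable_similarity.
Qed.

Lemma similarity_open S k A : similarity S k -> open A -> open (S @` A).
Proof.
move=> /[dup] sS /similarity_inv[S' [sS' c1 c2]] oA.
rewrite (_ : S @` A = S' @^-1` A); first by apply: open_comp => // x _; exact: similarity_continuous sS' x.
apply/seteqP; split => [_ [x Ax <-]|x Ax] /=; first by rewrite c1.
by exists (S' x).
Qed.

Lemma test_function_comp S k M phi : similarity S k ->
  test_function (S @` M) phi -> test_function M (phi \o S).
Proof.
move=> sS [s c h]; have [S' [sS' c1 c2]] := similarity_inv sS.
have cS := similarity_continuous sS; have cS' := similarity_continuous sS'.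
have sub : closure [set x | (phi \o S) x != 0] `<=` S @^-1` closure [set x | phi x != 0].
  move=> x cx U /cS /cx[y [/= y1 y2]]; by exists (S y).
split.
- by have [_ [a [b [e [p [q [_ _ ->]]]]]]] := sS; exact: smooth_comp_similarity.
- apply: (@subclosed_compact _ _ (S' @` closure [set x | phi x != 0])).
  + exact: closed_closure.
  + by apply: continuous_compact => //; exact: continuous_subspaceT.
  + by move=> x /sub Sx; exists (S x).
- by move=> x /sub /h[y My /(can_inj c1) <-].
Qed.

End TestFunctions.

Local Notation plane_mfun f := (measurable_fun
  [set: (measurableTypeR _ * measurableTypeR _)%type]
  (f : (measurableTypeR _ * measurableTypeR _)%type -> measurableTypeR _)).

(** * Square integrals and L2 convergence *)

Section SquareIntegral.
Context {R : realType}.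
Implicit Types (f g : plane R -> R) (A M : set (plane R)).
Local Notation mplane := (measurableTypeR R * measurableTypeR R)%type.

(** The squared L2 norm with values in [\bar R]. Working with squares keeps roots out of the
    estimates and suits polarisation, at the price of factors [2] in place of the triangle
    inequality. *)
Definition sq_integral f : \bar R := (\int[leb2 R]_x ((f x) ^+ 2)%:E)%E.

Lemma ae_plane_mono (P Q : plane R -> Prop) : (forall x, P x -> Q x) ->
  {ae leb2 R, forall x, P x} -> {ae leb2 R, forall x, Q x}.
Proof.
have F : Filter (almost_everywhere (leb2 R)) := ae_filter_ringOfSetsType _.
by move=> PQ; apply: (@filterS _ _ F).
Qed.

Lemma ae_plane_and (P Q : plane R -> Prop) : {ae leb2 R, forall x, P x} ->
  {ae leb2 R, forall x, Q x} -> {ae leb2 R, forall x, P x /\ Q x}.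
Proof.
have F : Filter (almost_everywhere (leb2 R)) := ae_filter_ringOfSetsType _.
by apply: (@filterI _ _ F).
Qed.

Lemma nneg_cvg0P (a : nat -> \bar R) : (forall n, (0 <= a n)%E) ->
  (a n @[n --> \oo] --> 0%E <->
   forall e : R, 0 < e -> \forall n \near \oo, (a n <= e%:E)%E).
Proof.
move=> a0; split=> [h e e0|h].
  have : nbhs (0 : \bar R)%E [set x : \bar R | (x < e%:E)%E].
    by apply: open_nbhs_nbhs; split; [exact: open_ereal_lt_ereal|rewrite /= lte_fin].
  move=> /h hN; apply: (@filterS _ \oo _ (fun n => (a n < e%:E)%E)) hN => n; exact: ltW.
apply/fine_cvgP; split.
  have := h _ ltr01; apply: filterS => n hn.
  by rewrite ge0_fin_numE// (le_lt_trans hn)// ltry.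
apply/cvgrPdist_le => e e0; have := h _ e0; apply: filterS => n hn /=.
rewrite sub0r normrN ger0_norm ?fine_ge0// -lee_fin fineK//.
by rewrite ge0_fin_numE// (le_lt_trans hn)// ltry.
Qed.

Lemma sq_integral_ge0 f : (0 <= sq_integral f)%E.
Proof. by apply: integral_ge0 => x _; rewrite lee_fin sqr_ge0. Qed.

Lemma Lnorm2E f : ('N[leb2 R]_(2%:E)[EFin \o f] = sq_integral f `^ 2^-1)%E.
Proof.
rewrite unlock /sq_integral; congr poweR; apply: eq_integral => x _ /=.
by rewrite powR_mulrn// real_normK ?num_real.
Qed.

Lemma L2_cvgP (v : nat -> plane R -> R) u :
  L2_cvg v u <-> forall e : R, 0 < e ->
    \forall n \near \oo, (sq_integral (v n \- u)%R <= e%:E)%E.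
Proof.
rewrite /L2_cvg; under eq_cvg do rewrite Lnorm2E.
rewrite nneg_cvg0P; last by move=> n; exact: poweR_ge0.
split => h e e0.
  have := h _ (_ : 0 < e `^ 2^-1); rewrite powR_gt0// => /(_ isT); apply: filterS => n hn.
  have : ((sq_integral (v n \- u)%R `^ 2^-1) `^ 2 <= (e `^ 2^-1)%:E `^ 2)%E.
    by apply: gt0_ler_poweR; rewrite ?in_itv/= ?leey ?poweR_ge0// lee_fin powR_ge0.
  rewrite -poweRrM mulVf// poweRe1 ?sq_integral_ge0// poweR_EFin -powRrM mulVf//.
  by rewrite powRr1// ltW.
have := h _ (_ : 0 < e ^+ 2); rewrite exprn_gt0// => /(_ isT); apply: filterS => n hn.
have -> : e%:E = ((e ^+ 2)%:E `^ 2^-1)%E.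
  by rewrite poweR_EFin -powR_mulrn ?ltW// -powRrM mulfV// powRr1// ltW.
by apply: gt0_ler_poweR; rewrite ?in_itv/= ?leey ?sq_integral_ge0// lee_fin sqr_ge0.
Qed.

Lemma measurable_sqr f : plane_mfun f ->
  measurable_fun [set: mplane] (fun x : mplane => ((f x) ^+ 2)%:E).
Proof. by move=> mf; apply/measurable_EFinP; exact: measurable_funX. Qed.

Lemma le_sq_integral f g : plane_mfun f -> plane_mfun g -> (forall x, `|f x| <= `|g x|) ->
  (sq_integral f <= sq_integral g)%E.
Proof.
move=> mf mg fg; apply: ge0_le_integral => //.
- by move=> x _; rewrite lee_fin sqr_ge0.
- exact: measurable_sqr.
- exact: measurable_sqr.
- move=> x _; rewrite lee_fin -[leLHS]real_normK ?num_real// -[leRHS]real_normK ?num_real//.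
  by rewrite lerXn2r ?nnegrE.
Qed.

(** Integrated form of [(x + y)^2 <= 2 x^2 + 2 y^2]; it holds in [\bar R], infinite values
    included. *)
Lemma sq_integral_lin (c d : R) f g : plane_mfun f -> plane_mfun g ->
  (sq_integral (fun x => c * f x + d * g x)%R <=
   (2 * c ^+ 2)%:E * sq_integral f + (2 * d ^+ 2)%:E * sq_integral g)%E.
Proof.
move=> mf mg.
have c2 : 0 <= 2 * c ^+ 2 by rewrite mulr_ge0// sqr_ge0.
have d2 : 0 <= 2 * d ^+ 2 by rewrite mulr_ge0// sqr_ge0.
rewrite -!ge0_integralZl//; do ?[by rewrite lee_fin|
  exact: measurable_sqr|by move=> x _; rewrite lee_fin sqr_ge0].
rewrite -ge0_integralD//; last 4 first.
- by move=> x _; apply: mule_ge0; rewrite lee_fin ?c2 ?d2// sqr_ge0.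
- by apply: measurable_funeM; exact: measurable_sqr.
- by move=> x _; apply: mule_ge0; rewrite lee_fin ?c2 ?d2// sqr_ge0.
- by apply: measurable_funeM; exact: measurable_sqr.
apply: ge0_le_integral => //.
- by move=> x _; rewrite lee_fin sqr_ge0.
- apply: measurable_sqr; apply: measurable_funD; exact: measurable_funM.
- apply: emeasurable_funD; apply: measurable_funeM; exact: measurable_sqr.
- move=> x _; rewrite -!EFinM -EFinD lee_fin.
  have := sqr_ge0 (c * f x - d * g x); rewrite !expr2; lra.
Qed.

Lemma L2_cvg_lin (c d : R) (v w : nat -> plane R -> R) f g :
  (forall n, plane_mfun (v n)) -> (forall n, plane_mfun (w n)) -> plane_mfun f -> plane_mfun g ->
  L2_cvg v f -> L2_cvg w g ->
  L2_cvg (fun n x => c * v n x + d * w n x) (fun x => c * f x + d * g x).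
Proof.
move=> mv mw mf mg /L2_cvgP vf /L2_cvgP wg; apply/L2_cvgP => e e0.
pose K := 2 * c ^+ 2 + 2 * d ^+ 2 + 1.
have c0 : 0 <= 2 * c ^+ 2 by rewrite mulr_ge0// sqr_ge0.
have d0 : 0 <= 2 * d ^+ 2 by rewrite mulr_ge0// sqr_ge0.
have K0 : 0 < K by rewrite /K ltr_wpDl// addr_ge0.
near=> n.
have -> : (fun x => c * v n x + d * w n x) \- (fun x => c * f x + d * g x) =
    (fun x => c * (v n \- f) x + d * (w n \- g) x).
  by apply/funext => x /=; ring.
apply: le_trans (sq_integral_lin _ _ _ _) _.
- by apply: measurable_funB => //; exact: mv.
- by apply: measurable_funB => //; exact: mw.
apply: (@le_trans _ _ ((2 * c ^+ 2)%:E * (e / K)%:E + (2 * d ^+ 2)%:E * (e / K)%:E)%E).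
  apply: leeD; apply: lee_wpmul2l; rewrite ?lee_fin//.
    by near: n; apply: vf; rewrite divr_gt0.
  by near: n; apply: wg; rewrite divr_gt0.
rewrite -!EFinM -EFinD lee_fin -mulrDl mulrCA ger_pMr// ler_pdivrMr// mul1r.
by rewrite /K lerDl.
Unshelve. all: by end_near. Qed.

Lemma sq_integral_eq0 f : plane_mfun f -> sq_integral f = 0%E ->
  {ae leb2 R, forall x, f x = 0}.
Proof.
move=> mf f0.
have : (\int[leb2 R]_x `|((f x) ^+ 2)%:E| = 0)%E.
  by rewrite -[RHS]f0; apply: eq_integral => x _; rewrite gee0_abs// lee_fin sqr_ge0.
move=> /(ae_eq_integral_abs _ measurableT (measurable_sqr mf)).
apply: ae_plane_mono => x /(_ I) [] /eqP; rewrite sqrf_eq0 => /eqP.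
by [].
Qed.

Lemma plane_mfun_restrict A f : measurable (A : set mplane) -> plane_mfun f -> plane_mfun (restrict A f).
Proof. by move=> mA mf; apply: measurable_funM => //; exact: measurable_indic. Qed.

Lemma L2_cvg_restrict A (v : nat -> plane R -> R) f : measurable (A : set mplane) ->
  (forall n, plane_mfun (v n)) -> plane_mfun f ->
  L2_cvg v f -> L2_cvg (fun n => restrict A (v n)) (restrict A f).
Proof.
move=> mA mv mf /L2_cvgP vf; apply/L2_cvgP => e /vf; apply: filterS => n; apply: le_trans.
apply: le_sq_integral.
- by apply: measurable_funB; apply: plane_mfun_restrict => //; exact: mv.
- by apply: measurable_funB => //; exact: mv.
move=> x /=; rewrite /restrict -mulrBr normrM.
by rewrite indicE; case: (_ \in _); rewrite /= ?normr1 ?normr0 ?mul1r ?mul0r.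
Qed.

(** Off [M] the approximation error is the limit itself up to sign, so the squared norm of [f] there
    is below every positive [e]. *)
Lemma L2_cvg_eq0 M (v : nat -> plane R -> R) f : measurable (M : set mplane) ->
  (forall n, plane_mfun (v n)) -> plane_mfun f -> L2_cvg v f ->
  (forall n x, ~ M x -> v n x = 0) -> {ae leb2 R, forall x, ~ M x -> f x = 0}.
Proof.
move=> mM mv mf vf v0.
have mC : measurable (~` (M : set mplane)) by exact: measurableC.
have /L2_cvgP h := L2_cvg_restrict mC mv mf vf.
have : sq_integral (restrict (~` M) f) = 0%E.
  apply/eqP; rewrite eq_le sq_integral_ge0 andbT; apply/lee_addgt0Pr => e e0.
  rewrite add0e; have [n _ /(_ n (leqnn n))] := h _ e0; apply: le_trans.
  apply: le_sq_integral; first exact: plane_mfun_restrict.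
    by apply: measurable_funB; apply: plane_mfun_restrict => //; exact: mv.
  move=> x /=; rewrite /restrict indicE.
  have [Mx|nMx] := pselect (M x); first by rewrite memNset ?mul0r ?normr0//; exact.
  by rewrite v0// mulr0 sub0r normrN.
move=> /(sq_integral_eq0 (plane_mfun_restrict mC mf)); apply: ae_plane_mono => x + nMx.
by rewrite /restrict indicE mem_set// mul1r.
Qed.

End SquareIntegral.

(** * Dirichlet eigenspaces *)

Section Eigenspaces.
Context {R : realType}.
Implicit Types (u f h phi : plane R -> R) (g : bool -> plane R -> R) (A B M : set (plane R)) (nu : R).
Local Notation mplane := (measurableTypeR R * measurableTypeR R)%type.

Lemma test_function_measurable M phi : test_function M phi -> plane_mfun phi.
Proof. by move=> /test_function_continuous; exact: continuous_measurable_plane. Qed.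

Lemma test_function_partial_measurable M phi i : test_function M phi -> plane_mfun (partial i phi).
Proof.
by move=> /(test_function_partial_continuous (i := i)); exact: continuous_measurable_plane.
Qed.

Lemma H10W M M' u g : M `<=` M' -> H10 M u g -> H10 M' u g.
Proof.
move=> MM' [mu mg [v [tv vu vg]]]; split => //; exists v; split => // n.
exact: test_functionW (tv n).
Qed.

Lemma H10_restrict A B u g : open A -> open B -> A `&` B = set0 ->
  H10 (A `|` B) u g -> H10 A (restrict A u) (fun i => restrict A (g i)).
Proof.
move=> oA oB AB0 [mu mg [v [tv vu vg]]].
have mA : measurable (A : set mplane) by exact: open_measurable_plane.
split; [exact: plane_mfun_restrict|move=> i; apply: plane_mfun_restrict => //; exact: mg|].
have tr n := test_function_restrict oA oB AB0 (tv n).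
exists (fun n => restrict A (v n)); split.
- by move=> n; exact: (tr n).1.
- by apply: L2_cvg_restrict => // n; exact: test_function_measurable (tv n).
- move=> i; under [X in L2_cvg X _]eq_fun do rewrite (tr _).2.
  apply: L2_cvg_restrict => //; last exact: mg.
  by move=> n; exact: test_function_partial_measurable _ (tv n).
Qed.

Lemma H10_eq0 M u g : open M -> H10 M u g ->
  {ae leb2 R, forall x, ~ M x -> u x = 0} /\
  forall i, {ae leb2 R, forall x, ~ M x -> g i x = 0}.
Proof.
move=> oM [mu mg [v [tv vu vg]]].
have mM : measurable (M : set mplane) by exact: open_measurable_plane.
split => [|i].
  apply: (L2_cvg_eq0 mM _ _ vu) => // [n|n x].
    exact: test_function_measurable (tv n).
  exact: test_function_eq0 (tv n).
apply: (L2_cvg_eq0 mM _ (mg i) (vg i)) => // [n|n x].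
  exact: test_function_partial_measurable _ (tv n).
exact: test_function_partial_eq0 _ (tv n).
Qed.

Lemma eigenspace_eq0 M nu u : open M -> dirichlet_eigenspace M nu u ->
  {ae leb2 R, forall x, ~ M x -> u x = 0}.
Proof. by move=> oM [g hg _]; exact: (H10_eq0 oM hg).1. Qed.

(** A test function on [A] is also one on the union, and it vanishes off [A] together with its
    partial derivatives, so restricting [u] and its gradient leaves the integrals unchanged. *)
Lemma eigenspace_restrict A B nu u : open A -> open B -> A `&` B = set0 ->
  dirichlet_eigenspace (A `|` B) nu u -> dirichlet_eigenspace A nu (restrict A u).
Proof.
move=> oA oB AB0 [g hg eg]; exists (fun i => restrict A (g i)).
  exact: H10_restrict hg.
move=> phi tphi.
have := eg _ (test_functionW (@subsetUl _ A B) tphi) => e.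
transitivity (\int[leb2 R]_x (g false x * partial false phi x + g true x * partial true phi x)).
  apply: eq_Rintegral => x _; rewrite /restrict indicE.
  have [Ax|nAx] := pselect (A x); first by rewrite mem_set// !mul1r.
  by rewrite !(test_function_partial_eq0 _ tphi nAx) !mulr0.
rewrite e; apply: eq_Rintegral => x _; rewrite /restrict indicE.
have [Ax|nAx] := pselect (A x); first by rewrite mem_set// !mul1r.
by rewrite (test_function_eq0 tphi nAx) !mulr0.
Qed.

Lemma ae_eq_Rintegral_plane f h : plane_mfun f -> plane_mfun h ->
  {ae leb2 R, forall x, f x = h x} -> \int[leb2 R]_x f x = \int[leb2 R]_x h x.
Proof.
move=> mf mg fg; congr fine; apply: ae_eq_integral => //; try exact/measurable_EFinP.
by apply: ae_plane_mono fg => x /= -> _.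
Qed.

(** Here the test function lives on the union and is replaced by its restriction to [A]. This
    changes the integrands only off [A], where [u] and its weak gradient vanish almost
    everywhere. *)
Lemma eigenspace_setU A B nu u : open A -> open B -> A `&` B = set0 ->
  dirichlet_eigenspace A nu u -> dirichlet_eigenspace (A `|` B) nu u.
Proof.
move=> oA oB AB0 [g hg eg]; exists g; first exact: H10W hg.
have [mu mg _] := hg.
move=> phi tphi.
have mA : measurable (A : set mplane) by exact: open_measurable_plane.
have [tr dr] := test_function_restrict oA oB AB0 tphi.
have mp := test_function_measurable tphi.
have mdp i := test_function_partial_measurable i tphi.
have [u0 g0] := H10_eq0 oA hg.
have AE f h : {ae leb2 R, forall x, ~ A x -> f x = 0} ->
    {ae leb2 R, forall x, f x * restrict A h x = f x * h x}.
  apply: ae_plane_mono => x f0; rewrite /restrict indicE.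
  have [Ax|nAx] := pselect (A x); first by rewrite mem_set// !mul1r.
  by rewrite f0// !mul0r.
have := eg _ tr; rewrite !dr => e.
transitivity (\int[leb2 R]_x (g false x * restrict A (partial false phi) x +
   g true x * restrict A (partial true phi) x)).
  apply: ae_eq_Rintegral_plane.
  - by apply: measurable_funD; apply: measurable_funM; do ?[exact: mg|exact: mdp].
  - by apply: measurable_funD; apply: measurable_funM;
      do ?[exact: mg|apply: plane_mfun_restrict => //; exact: mdp].
  - have := ae_plane_and (AE _ (partial false phi) (g0 false))
      (AE _ (partial true phi) (g0 true)).
    by apply: ae_plane_mono => x [-> ->].
rewrite e; apply: ae_eq_Rintegral_plane.
- by apply: measurable_funM; [exact: measurable_funM|exact: plane_mfun_restrict].
- by apply: measurable_funM => //; exact: measurable_funM.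
- by have := AE _ phi u0; apply: ae_plane_mono => x; rewrite -!mulrA => ->.
Qed.

End Eigenspaces.

(** * Transport of eigenfunctions by similarities *)

Section SimilarEigenspaces.
Context {R : realType}.
Implicit Types (u f h phi : plane R -> R) (g : bool -> plane R -> R) (A B M : set (plane R)) (nu : R).
Local Notation mplane := (measurableTypeR R * measurableTypeR R)%type.

Lemma ge0_integral_comp_scaling (S : plane R -> plane R) k (f : mplane -> \bar R) :
  measure_scaling S k -> measurable_fun [set: mplane] f -> (forall x, (0 <= f x)%E) ->
  (\int[leb2 R]_x f (S x) = k%:E * \int[leb2 R]_x f x)%E.
Proof.
move=> [k0 mS hS] mf f0.
transitivity (\int[pushforward (leb2 R) (S : mplane -> mplane)]_x f x)%E.
  by rewrite ge0_integral_pushforward// => x _; exact: f0.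
transitivity (\int[mscale (NngNum (ltW k0)) (leb2 R)]_x f x)%E.
  by apply: eq_measure_integral => A mA _; exact: hS.
exact: ge0_integral_mscale.
Qed.

(** No integrability is involved: [fine] sends infinite values to [0], and the positive factor [k]
    keeps infinite parts infinite, so both sides degenerate together. The change of variables thus
    applies to the weak equation directly. *)
Lemma Rintegral_posneg_scale f h k : 0 < k ->
  (\int[leb2 R]_x (EFin \o f)^\+ x = k%:E * \int[leb2 R]_x (EFin \o h)^\+ x)%E ->
  (\int[leb2 R]_x (EFin \o f)^\- x = k%:E * \int[leb2 R]_x (EFin \o h)^\- x)%E ->
  \int[leb2 R]_x f x = k * \int[leb2 R]_x h x.
Proof.
move=> k0; rewrite /Rintegral => hp hn.
rewrite [X in fine X = _]integralE [X in _ * fine X]integralE hp hn.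
set a := (\int[_]_x (_^\+ x))%E; set b := (\int[_]_x (_^\- x))%E.
have a0 : (0 <= a)%E by apply: integral_ge0 => x _.
have b0 : (0 <= b)%E by apply: integral_ge0 => x _.
clearbody a b; clear hp hn; have kE : (0 < k%:E)%E by rewrite lte_fin.
case: a a0 => [a _|_|//]; case: b b0 => [b _|_|//];
  rewrite ?(gt0_muley kE)/= ?mulr0//.
by rewrite mulrBr.
Qed.

Lemma Rintegral_comp_scaling (S : plane R -> plane R) k f :
  measure_scaling S k -> plane_mfun f ->
  \int[leb2 R]_x f (S x) = k * \int[leb2 R]_x f x.
Proof.
move=> hS mf; have [k0 _ _] := hS.
have mf' : measurable_fun [set: mplane] (fun x : mplane => (f x)%:E) by exact/measurable_EFinP.
apply: Rintegral_posneg_scale => //.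
  rewrite -(ge0_integral_comp_scaling (f := ((EFin \o f)^\+)%E) hS)//.
    by apply: eq_integral => x _; rewrite !funeposE.
  exact: measurable_funepos.
rewrite -(ge0_integral_comp_scaling (f := ((EFin \o f)^\-)%E) hS)//.
  by apply: eq_integral => x _; rewrite !funenegE.
exact: measurable_funeneg.
Qed.

Lemma RintegralZl_gt0 k f : 0 < k -> plane_mfun f ->
  \int[leb2 R]_x (k * f x) = k * \int[leb2 R]_x f x.
Proof.
move=> k0 mf.
have mf' : measurable_fun [set: mplane] (fun x : mplane => (f x)%:E) by exact/measurable_EFinP.
apply: Rintegral_posneg_scale => //; rewrite -ge0_integralZl//;
  do ?[exact: measurable_funepos|exact: measurable_funeneg|by rewrite lee_fin ltW].
  apply: eq_integral => x _; rewrite (_ : EFin \o _ = (fun y => k%:E * (f y)%:E)%E)//.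
  by rewrite ge0_funeposM// ltW.
apply: eq_integral => x _; rewrite (_ : EFin \o _ = (fun y => k%:E * (f y)%:E)%E)//.
by rewrite ge0_funenegM// ltW.
Qed.

Lemma plane_mfun_comp S k f : similarity S k -> plane_mfun f -> plane_mfun (f \o S).
Proof.
move=> /similarity_measure_scaling[k' [_ mS _]] mf.
exact: (measurableT_comp mf mS).
Qed.

Lemma L2_cvg_comp S k (v : nat -> plane R -> R) f : similarity S k ->
  (forall n, plane_mfun (v n)) -> plane_mfun f -> L2_cvg v f ->
  L2_cvg (fun n => v n \o S) (f \o S).
Proof.
move=> /similarity_measure_scaling[k' hS] mv mf /L2_cvgP vf; apply/L2_cvgP => e e0.
have [k0 _ _] := hS.
have := vf (e / k') (divr_gt0 e0 k0); apply: filterS => n hn.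
rewrite /sq_integral (ge0_integral_comp_scaling (f := fun x => ((v n x - f x) ^+ 2)%:E) hS).
- apply: (@le_trans _ _ (k'%:E * (e / k')%:E)%E).
    by apply: lee_wpmul2l => //; rewrite lee_fin ltW.
  by rewrite -EFinM mulrC divfK ?gt_eqF.
- by apply: measurable_sqr; apply: measurable_funB => //; exact: mv.
- by move=> x; rewrite lee_fin sqr_ge0.
Qed.

(** The linear part of [S] is the square root of [k] times an orthogonal matrix, so the scalar
    product of gradients gains the factor [k], while the area factor is common to both sides. Every
    test function on [M] has the form [psi \o S], with [psi] obtained from the inverse
    similarity. *)
Lemma eigenspace_comp S k M nu u : similarity S k ->
  dirichlet_eigenspace (S @` M) nu u -> dirichlet_eigenspace M (k * nu) (u \o S).
Proof.
move=> sS [g [mu mg [v [tv vu vg]]] eg].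
have [S' [sS' c1 c2]] := similarity_inv sS.
have [k0 [a [b [e [p [q [e1 abk SE]]]]]]] := sS.
pose c i := if i then - (e * b) else a; pose d i := if i then e * a else b.
have pS i phi : (forall x, differentiable phi x) ->
    partial i (phi \o S) = (fun x => c i * (partial false phi \o S) x +
      d i * (partial true phi \o S) x).
  by move=> dphi; apply/funext => x; rewrite SE partial_comp_similarity.
exists (fun i x => c i * (g false \o S) x + d i * (g true \o S) x).
  split; first by apply: (plane_mfun_comp sS); exact: mu.
    move=> i; apply: measurable_funD; apply: measurable_funM => //;
      by apply: (plane_mfun_comp sS); exact: mg.
  exists (fun n => v n \o S); split.
  - by move=> n; apply: (test_function_comp sS); exact: tv.
  - apply: (L2_cvg_comp sS) => // n; exact: test_function_measurable (tv n).
  - move=> i; under [X in L2_cvg X _]eq_fun.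
      move=> n; rewrite pS; last by move=> x; apply: smoothW; have [] := tv n.
      over.
    have mv j n := test_function_partial_measurable j (tv n).
    have h1 j n : plane_mfun (partial j (v n) \o S) by apply: (plane_mfun_comp sS); exact: mv.
    have h2 j : plane_mfun (g j \o S) by apply: (plane_mfun_comp sS); exact: mg.
    have h3 j : L2_cvg (fun n => partial j (v n) \o S) (g j \o S).
      by apply: (L2_cvg_comp sS); [exact: mv|exact: mg|exact: vg].
    exact: L2_cvg_lin.
move=> phi tphi.
pose psi := phi \o S'.
have tpsi : test_function (S @` M) psi.
  apply: (test_function_comp sS'); apply: test_functionW tphi.
  by move=> x Mx; exists (S x); [exists x|exact: c1].
have phiE : phi = psi \o S by apply/funext => x; rewrite /psi /= c1.
have [k' hS] := similarity_measure_scaling sS.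
have dpsi x : differentiable psi x by apply: smoothW; have [] := tpsi.
have mpsi i := test_function_partial_measurable i tpsi.
pose F x := g false x * partial false psi x + g true x * partial true psi x.
(* Because [e ^+ 2 = 1], the mixed products of the two components cancel and the squared
   coefficients add up to [a ^+ 2 + b ^+ 2 = k]. *)
transitivity (\int[leb2 R]_x ((fun y => k * F y) (S x))).
  apply: eq_Rintegral => x _; rewrite phiE !pS// /c /d /F /= -abk.
  move: e1 => /eqP; rewrite sqrf_eq1 => /pred2P[] ->; ring.
have mF : plane_mfun F.
  by apply: measurable_funD; apply: measurable_funM; do ?[exact: mg|exact: mpsi].
rewrite (Rintegral_comp_scaling (f := fun y => k * F y) hS); last exact: measurable_funM.
rewrite RintegralZl_gt0// (eg _ tpsi).
have mG : plane_mfun (fun x => nu * u x * psi x).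
  apply: measurable_funM; first exact: measurable_funM.
  exact: test_function_measurable tpsi.
transitivity (\int[leb2 R]_x (fun y => k * (nu * u y * psi y)) (S x)).
  rewrite (Rintegral_comp_scaling (f := fun y => k * (nu * u y * psi y)) hS).
    by rewrite RintegralZl_gt0.
  exact: measurable_funM.
by apply: eq_Rintegral => x _; rewrite phiE /= !mulrA.
Qed.

End SimilarEigenspaces.

(** * Poincare inequality and spectral gap *)

Section Poincare.
Context {R : realType}.
Implicit Types (u f phi : plane R -> R) (g : bool -> plane R -> R) (A M : set (plane R)) (nu : R).
Local Notation mplane := (measurableTypeR R * measurableTypeR R)%type.
Local Notation leb := (@lebesgue_measure R).

(* Integrate 0 <= (h + 2 x h')^2 = 4 x^2 h'^2 + 2 (x h^2)' - h^2. *)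
Lemma poincare_itv (B : R) (h h' : R -> R) : 0 < B ->
  (forall x : R, is_derive x (1 : R) h (h' x)) -> continuous h' -> h B = 0 -> h (- B) = 0 ->
  (\int[leb]_(x in `[(- B)%R, B]) ((h x) ^+ 2)%:E <=
   (4 * B ^+ 2)%:E * \int[leb]_(x in `[(- B)%R, B]) ((h' x) ^+ 2)%:E)%E.
Proof.
move=> B0 dh ch' hB hNB.
have ch : continuous h.
  by move=> x; apply/differentiable_continuous/derivable1_diffP; case: (dh x).
have csqr (k : R -> R) : continuous k -> continuous (fun x => k x ^+ 2).
  by move=> ck x; exact: (cvgM (ck x) (ck x)).
pose H x := x * h x ^+ 2; pose H' x := h x ^+ 2 + 2 * x * h x * h' x.
have dH (x : R) : is_derive x (1 : R) H (H' x).
  have ? := dh x.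
  have : is_derive x (1 : R) (id * h ^+ 2) (x *: (2%N%:R * h x ^+ 1 *: h' x) + h x ^+ 2 *: 1).
    apply: is_deriveM.
  rewrite /H' /GRing.scale/= => /is_derive_eq; apply; ring.
have cH' : continuous H'.
  move=> x; apply: (@cvgD _ _ _ _ _ (fun x => h x ^+ 2)).
    exact: csqr ch x.
  apply: cvgM; last exact: ch'.
  by apply: cvgM; [apply: cvgM; [exact: cvg_cst|exact: cvg_id]|exact: ch].
have NBB : - B < B by rewrite gtrN.
have I0 : (\int[leb]_(x in `[(- B)%R, B]) (H' x)%:E = 0)%E.
  rewrite (@continuous_FTC2 _ H' H)//.
  - by rewrite /H hB hNB expr0n !mulr0 sube0.
  - exact: continuous_subspaceT.
  - split.
    + by move=> x _; case: (dH x).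
    + apply: cvg_at_right_filter; apply/differentiable_continuous/derivable1_diffP.
      by case: (dH (- B)).
    + apply: cvg_at_left_filter; apply/differentiable_continuous/derivable1_diffP.
      by case: (dH B).
  - by move=> x _; rewrite derive1E; case: (dH x).
have int (k : R -> R) : continuous k -> leb.-integrable `[(- B)%R, B] (EFin \o k).
  move=> ck; apply: continuous_compact_integrable; first exact: segment_compact.
  exact: continuous_subspaceT.
rewrite -ge0_integralZl//; last 3 first.
- apply/measurable_EFinP/measurable_funX; apply: measurable_funTS.
  exact: continuous_measurable_fun.
- by move=> x _; rewrite lee_fin sqr_ge0.
- by rewrite lee_fin mulr_ge0// sqr_ge0.
have cx2 : continuous (fun x => h x ^+ 2) by exact: csqr.
have cx2' : continuous (fun x => h' x ^+ 2) by exact: csqr.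
(* [K] dominates [h ^+ 2] pointwise since [x ^+ 2 <= B ^+ 2] on the interval, and its second term
   integrates to [0] because [h] vanishes at both ends. *)
pose K x := 4 * B ^+ 2 * h' x ^+ 2 + 2 * H' x.
have -> : (\int[leb]_(x in `[(- B)%R, B]) ((4 * B ^+ 2)%:E * ((h' x) ^+ 2)%:E) =
   \int[leb]_(x in `[(- B)%R, B]) (K x)%:E)%E.
  rewrite /K [RHS](_ : _ = \int[leb]_(x in `[(- B)%R, B]) (((4 * B ^+ 2)%:E * ((h' x) ^+ 2)%:E)
     + 2%:E * (H' x)%:E))%E; last first.
    by apply: eq_integral => x _; rewrite EFinD !EFinM.
  rewrite integralD//; last 2 first.
  - by apply: integrableZl => //; exact: int.
  - by apply: integrableZl => //; exact: int.
  by rewrite (integralZl _ (int _ cH'))// I0 mule0 adde0.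
apply: le_integral => //; first exact: int.
  by apply: int => x; apply: cvgD; apply: cvgM; do ?[exact: cvg_cst|exact: cx2'|exact: cH'].
move=> x; rewrite inE/= in_itv/= => /andP[xl xr]; rewrite lee_fin /K /H'.
have x2 : x ^+ 2 <= B ^+ 2.
  by rewrite -[leLHS]real_normK ?num_real// lerXn2r ?nnegrE ?ler_norml ?xl// ltW.
have := sqr_ge0 (h x + 2 * x * h' x).
have := ler_wpM2r (sqr_ge0 (h' x)) x2.
rewrite !expr2; nra.
Qed.

Lemma is_derive_section phi x y : differentiable phi (x, y) ->
  is_derive y (1 : R) (fun y => phi (x, y)) (partial true phi (x, y)).
Proof.
move=> dphi; have dv := @diff_derivable _ _ _ phi (x, y) (0, 1) dphi.
have E : (fun t : R => t^-1 *: (((fun y => phi (x, y)) \o shift y) (t *: 1) - phi (x, y))) =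
   (fun t : R => t^-1 *: ((phi \o shift (x, y)) (t *: ((0, 1) : plane R)) - phi (x, y))).
  apply/funext => t /=; congr (_ *: (phi _ - _)); congr pair.
  by rewrite [RHS](_ : _ = t * 0 + x)// mulr0 add0r.
split; first by rewrite /derivable E.
by rewrite /partial /derive E.
Qed.

(** The one-dimensional inequality holds on every vertical line and is integrated by Tonelli; hence
    only the second partial derivative and the vertical extent appear. *)
Lemma poincare_test_function (B : R) phi : 0 < B -> smooth phi ->
  (forall x, B <= `|x.2| -> phi x = 0) ->
  (sq_integral phi <= (4 * B ^+ 2)%:E * sq_integral (partial true phi))%E.
Proof.
move=> B0 sphi phi0.
have cphi : continuous phi by move=> x; exact/differentiable_continuous/smoothW.
have cdphi : continuous (partial true phi).
  by move=> x; exact/differentiable_continuous/smoothW/smooth_partial.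
have m1 := measurable_sqr (continuous_measurable_plane cphi).
have m2 := measurable_sqr (continuous_measurable_plane cdphi).
rewrite /sq_integral !fubini_tonelli1//; try by move=> x; rewrite lee_fin sqr_ge0.
have mF1 := measurable_fun_fubini_tonelli_F (m2 := leb) _ m1.
have mF2 := measurable_fun_fubini_tonelli_F (m2 := leb) _ m2.
have B4 : (0 <= (4 * B ^+ 2)%:E)%E by rewrite lee_fin mulr_ge0// sqr_ge0.
have F0 f x : (0 <= fubini_F leb (fun z : mplane => ((f z : R) ^+ 2)%:E) x)%E.
  by apply: integral_ge0 => y _; rewrite lee_fin sqr_ge0.
rewrite -ge0_integralZl//; last by apply: mF2 => z; rewrite lee_fin sqr_ge0.
apply: ge0_le_integral => //.
- by apply: mF1 => z; rewrite lee_fin sqr_ge0.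
- by apply: measurable_funeM; apply: mF2 => z; rewrite lee_fin sqr_ge0.
move=> x _; rewrite /fubini_F.
have -> : (\int[leb]_y ((phi (x, y)) ^+ 2)%:E =
    \int[leb]_(y in `[(- B)%R, B]) ((phi (x, y)) ^+ 2)%:E)%E.
  rewrite [RHS]integral_mkcond; apply: eq_integral => y _; rewrite patchE.
  case: ifPn => //; rewrite notin_setE/= in_itv/= => /negP; rewrite -ler_norml -ltNge => By.
  by rewrite phi0 ?expr0n//= ltW.
apply: (@le_trans _ _ ((4 * B ^+ 2)%:E *
    \int[leb]_(y in `[(- B)%R, B]) ((partial true phi (x, y)) ^+ 2)%:E)%E).
  apply: (poincare_itv (h := fun y => phi (x, y)) (h' := fun y => partial true phi (x, y))) => //.
  - by move=> y; apply: is_derive_section; exact: smoothW.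
  - move=> y; apply: (@continuous_comp _ _ _ (fun y => (x, y)) (partial true phi)).
      by apply: (@cvg_pair _ _ _ _ (nbhs x) (nbhs y)); [exact: cvg_cst|exact: cvg_id].
    exact: cdphi.
  - by apply: phi0; rewrite /= ler_norm.
  - by apply: phi0; rewrite /= normrN ler_norm.
apply: lee_wpmul2l => //; apply: ge0_subset_integral => //.
  have := measurable_fun_pair2 x m2; exact.
by move=> y _; rewrite lee_fin sqr_ge0.
Qed.

End Poincare.

Section SpectralGap.
Context {R : realType}.
Implicit Types (u f h phi : plane R -> R) (g : bool -> plane R -> R) (A M : set (plane R)) (nu : R).
Local Notation mplane := (measurableTypeR R * measurableTypeR R)%type.

Lemma sq_integrable f : plane_mfun f -> (sq_integral f < +oo)%E ->
  (leb2 R).-integrable [set: mplane] (fun x => ((f x) ^+ 2)%:E).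
Proof.
move=> mf ff; apply/integrableP; split; first exact: measurable_sqr.
apply: le_lt_trans ff; rewrite le_eqVlt; apply/orP; left; apply/eqP.
by apply: eq_integral => x _; rewrite gee0_abs// lee_fin sqr_ge0.
Qed.

Lemma integrable_sq f : (leb2 R).-integrable [set: mplane] (fun x => ((f x) ^+ 2)%:E) ->
  (sq_integral f < +oo)%E.
Proof.
move=> /integrableP[_]; apply: le_lt_trans; rewrite le_eqVlt; apply/orP; left; apply/eqP.
by apply: eq_integral => x _; rewrite gee0_abs// lee_fin sqr_ge0.
Qed.

Lemma sq_integral_fineK f : (sq_integral f < +oo)%E ->
  (fine (sq_integral f))%:E = sq_integral f.
Proof. by move=> ff; rewrite fineK// ge0_fin_numE// sq_integral_ge0. Qed.

Lemma sq_integral_sub_lty f h : plane_mfun f -> plane_mfun h -> (sq_integral f < +oo)%E ->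
  (sq_integral h < +oo)%E -> (sq_integral (f \- h)%R < +oo)%E.
Proof.
move=> mf mh ff fh.
have -> : f \- h = (fun x => 1 * f x + (- 1) * h x) by apply/funext => x /=; rewrite mul1r mulN1r.
apply: le_lt_trans (sq_integral_lin _ _ mf mh) _.
rewrite sqrrN expr1n mulr1.
by apply: lte_add_pinfty; apply: lte_mul_pinfty => //; rewrite lee_fin.
Qed.

Local Notation intable f :=
  ((leb2 R).-integrable [set: mplane] (fun x : mplane => (f x)%:E)).

Lemma RintegralD_plane f h : intable f -> intable h ->
  \int[leb2 R]_x (f x + h x) = \int[leb2 R]_x f x + \int[leb2 R]_x h x.
Proof. by move=> i1 i2; exact: (RintegralD measurableT i1 i2). Qed.

Lemma RintegralB_plane f h : intable f -> intable h ->
  \int[leb2 R]_x (f x - h x) = \int[leb2 R]_x f x - \int[leb2 R]_x h x.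
Proof. by move=> i1 i2; exact: (RintegralB measurableT i1 i2). Qed.

Lemma RintegralZl_plane (k : R) f : intable f ->
  \int[leb2 R]_x (k * f x) = k * \int[leb2 R]_x f x.
Proof. by move=> i; exact: (RintegralZl k measurableT i). Qed.

(** From [f h = (f^2 + h^2 - (h - f)^2) / 2]. It gives integrability of the product and turns the
    weak equation into a relation between squared norms, in which approximation errors appear
    explicitly. *)
Lemma Rintegral_polar f h : plane_mfun f -> plane_mfun h -> (sq_integral f < +oo)%E ->
  (sq_integral h < +oo)%E -> (leb2 R).-integrable [set: mplane] (fun x => (f x * h x)%:E) /\
  \int[leb2 R]_x (f x * h x) = 2^-1 * (fine (sq_integral f) + fine (sq_integral h) -
    fine (sq_integral (h \- f)%R)).
Proof.
move=> mf mh ff fh.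
have i1 := sq_integrable mf ff; have i2 := sq_integrable mh fh.
have i3 := sq_integrable (measurable_funB mh mf) (sq_integral_sub_lty mh mf fh ff).
have E : (fun x : mplane => (f x * h x)%:E) =
   (fun x : mplane => (2^-1 * (f x ^+ 2 + h x ^+ 2 - (h \- f) x ^+ 2))%:E).
  by apply/funext => x; congr EFin => /=; field.
have i4 : (leb2 R).-integrable [set: mplane]
   (EFin \o (fun x : mplane => f x ^+ 2 + h x ^+ 2)).
  exact: (integrableD measurableT i1 i2).
have i5 : (leb2 R).-integrable [set: mplane]
   (EFin \o (fun x : mplane => f x ^+ 2 + h x ^+ 2 - (h \- f) x ^+ 2)).
  exact: (integrableB measurableT i4 i3).
split; first by rewrite E; exact: (integrableZl measurableT _ i5).
transitivity (\int[leb2 R]_x (2^-1 * (f x ^+ 2 + h x ^+ 2 - (h \- f) x ^+ 2))).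
  by rewrite /Rintegral E.
rewrite (RintegralZl_plane _ i5); congr (_ * _).
rewrite (RintegralB_plane (f := fun x => f x ^+ 2 + h x ^+ 2) i4 i3).
by rewrite (RintegralD_plane i1 i2).
Qed.

Lemma L2_cvg_lty (v : nat -> plane R -> R) f : (forall n, plane_mfun (v n)) -> plane_mfun f ->
  (forall n, (sq_integral (v n) < +oo)%E) -> L2_cvg v f -> (sq_integral f < +oo)%E.
Proof.
move=> mv mf fv /L2_cvgP /(_ 1 ltr01)[n _ /(_ n (leqnn n)) hn].
have -> : f = v n \- (v n \- f) by apply/funext => x /=; ring.
apply: sq_integral_sub_lty => //; first by apply: measurable_funB => //; exact: mv.
by apply: le_lt_trans hn _; rewrite ltry.
Qed.

(* U, V, D0, D1, G0, G1 stand for the squared L2 norms of an eigenfunction u, of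
   an approximating test function v, of its partial derivatives, and of the weak
   gradient of u; a, b0, b1 for those of the approximation errors.  The equation
   is the weak form of the eigenvalue equation tested against v, polarised. *)
Lemma spectral_gap_estimate (C nu U V a D0 D1 G0 G1 b0 b1 : R) : 0 < C -> nu < (6 * C)^-1 ->
  U <= 2 * V + 2 * a -> V <= C * D1 ->
  0 <= U -> 0 <= V -> 0 <= D0 -> 0 <= G1 -> 0 <= G0 -> 0 <= b1 -> 0 <= b0 -> 0 <= a ->
  2^-1 * (G0 + D0 - b0) + 2^-1 * (G1 + D1 - b1) = nu * (2^-1 * (U + V - a)) ->
  U <= (4 * C + 4 + 2 * C * `|nu|) * (b0 + b1 + a).
Proof.
move=> C0 nuc hU hV U0 V0 D00 G10 G00 b10 b00 a0 E.
have {}E : D1 <= b0 + b1 + nu * (U + V - a) by lra.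
have nuC : 6 * (C * nu) < 1.
  by rewrite mulrA -ltr_pdivlMl ?mulr_gt0// mulr1.
have bK : D1 * C <= C * (b0 + b1) + C * nu * (U + V - a).
  by rewrite mulrC; have := ler_wpM2l (ltW C0) E; rewrite mulrDr mulrA.
have b0K : 0 <= C * (b0 + b1) by rewrite mulr_ge0 ?addr_ge0// ltW.
(* For [nu >= 0], [U + V - a <= 3 V + a] and [C nu < 1 / 6], so at most half of [V] reappears on the
   right and is absorbed; this fixes the threshold [(6 * C)^-1]. For [nu < 0] the terms in [U] and
   [V] have the good sign, and only [a] remains, with the coefficient that accounts for [|nu|] in
   the bound. *)
have [nu0|nu0] := leP 0 nu.
  have Cnu0 : 0 <= C * nu by rewrite mulr_ge0// ltW.
  have h1 : C * nu * (U + V - a) <= C * nu * (3 * V + a).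
    by apply: ler_wpM2l => //; lra.
  have h2 : C * nu * (3 * V + a) <= 6^-1 * (3 * V + a).
    by apply: ler_wpM2r; lra.
  have h3 : 0 <= C * nu * (b0 + b1 + a) by rewrite mulr_ge0// !addr_ge0.
  have h4 : 0 <= C * a by rewrite mulr_ge0// ltW.
  rewrite (ger0_norm nu0); lra.
have Cnu0 : 0 <= C * - nu by apply: mulr_ge0; rewrite ?oppr_ge0 ltW.
have h1 : 0 <= C * - nu * (U + V) by rewrite mulr_ge0// addr_ge0.
have h3 : 0 <= C * - nu * (b0 + b1) by rewrite mulr_ge0// addr_ge0.
have h4 : 0 <= C * a by rewrite mulr_ge0// ltW.
rewrite (ltr0_norm nu0); lra.
Qed.

(** The equation is tested against the test functions that approximate [u], for which the Poincare
    inequality is at hand. The squared norm of [u] is then bounded by a constant times the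
    approximation errors, which tend to [0]. *)
Lemma spectral_gap M : bounded_set M ->
  exists2 c : R, 0 < c & forall nu u, nu < c -> dirichlet_eigenspace M nu u ->
    {ae leb2 R, forall x, u x = 0}.
Proof.
move=> [B0 [_ hB0]].
pose B := `|B0| + 1; have B_gt0 : 0 < B by rewrite ltr_wpDl.
(* The bound is strict so that test functions on [M] vanish on the lines [|x.2| = B + 1]
   themselves. *)
have hB x : M x -> `|x.2| < B + 1.
  move=> Mx; have /= := hB0 B (ltr_pwDr ltr01 (ler_norm B0)) x Mx.
  rewrite prod_normE ge_max => /andP[_ h]; apply: le_lt_trans h _.
  by rewrite ltrDl.
pose C := 4 * (B + 1) ^+ 2.
have B1 : 0 < B + 1 by rewrite addr_gt0.
have C0 : 0 < C by rewrite mulr_gt0// exprn_gt0.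
exists (6 * C)^-1; first by rewrite invr_gt0 mulr_gt0.
move=> nu u nuc [g [mu mg [v [tv vu vg]]] eg].
have mv n := test_function_measurable (tv n).
have mdv i n := test_function_partial_measurable i (tv n).
have fv n : (sq_integral (v n) < +oo)%E := integrable_sq (test_function_integrable_sqr (tv n)).
have fdv i n : (sq_integral (partial i (v n)) < +oo)%E :=
  integrable_sq (test_function_partial_integrable_sqr i (tv n)).
have fu : (sq_integral u < +oo)%E by exact: L2_cvg_lty vu.
have fg i : (sq_integral (g i) < +oo)%E by apply: L2_cvg_lty (vg i) => //; exact: mg.
apply: sq_integral_eq0 => //; apply/eqP; rewrite eq_le sq_integral_ge0 andbT.
rewrite -(sq_integral_fineK fu) lee_fin; set U := fine _.
pose K := 4 * C + 4 + 2 * C * `|nu|.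
have K0 : 0 < K.
  by have := mulr_ge0 (ltW C0) (normr_ge0 nu); rewrite /K; lra.
apply/ler_addgt0Pr => e e0; rewrite add0r.
(* The estimate multiplies by [K] the sum of three errors: that of [u] and those of the two
   components of its gradient. *)
pose e1 := e / (3 * K); have e10 : 0 < e1 by rewrite divr_gt0// mulr_gt0.
move/L2_cvgP: vu => /(_ _ e10) [n1 _ hn1].
have := vg false => /L2_cvgP /(_ _ e10) [n2 _ hn2].
have := vg true => /L2_cvgP /(_ _ e10) [n3 _ hn3].
pose n := maxn n1 (maxn n2 n3).
have {hn1} h1 := hn1 n (leq_maxl _ _).
have {hn2} h2 := hn2 n (leq_trans (leq_maxl _ _) (leq_maxr _ _)).
have {hn3} h3 := hn3 n (leq_trans (leq_maxr _ _) (leq_maxr _ _)).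
have := eg _ (tv n).
have [ig0 Eg0] := Rintegral_polar (mg false) (mdv false n) (fg false) (fdv false n).
have [ig1 Eg1] := Rintegral_polar (mg true) (mdv true n) (fg true) (fdv true n).
have [iu Eu] := Rintegral_polar mu (mv n) fu (fv n).
rewrite (RintegralD_plane ig0 ig1) Eg0 Eg1.
under [RHS]eq_Rintegral do rewrite -mulrA.
rewrite (RintegralZl_plane nu iu) Eu.
have fdiff f h : plane_mfun f -> plane_mfun h -> (sq_integral f < +oo)%E -> (sq_integral h < +oo)%E ->
    (sq_integral (f \- h)%R <= e1%:E)%E -> 0 <= fine (sq_integral (f \- h)%R) <= e1.
  move=> mf mh ff fh fhe; rewrite fine_ge0 ?sq_integral_ge0//=.
  by rewrite -lee_fin sq_integral_fineK//; exact: sq_integral_sub_lty.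
have {h1} := fdiff _ _ (mv n) mu (fv n) fu h1.
have {h2} := fdiff _ _ (mdv false n) (mg false) (fdv _ _) (fg _) h2.
have {h3} := fdiff _ _ (mdv true n) (mg true) (fdv _ _) (fg _) h3.
have hU : U <= 2 * fine (sq_integral (v n)) + 2 * fine (sq_integral (v n \- u)%R).
  rewrite /U -lee_fin EFinD !EFinM !sq_integral_fineK//; last exact: sq_integral_sub_lty.
  have := @sq_integral_lin _ 1 (-1) (v n) (v n \- u) (mv n) (measurable_funB (mv n) mu).
  rewrite sqrrN !expr1n mulr1; apply: le_trans; rewrite le_eqVlt; apply/orP; left; apply/eqP.
  by congr sq_integral; apply/funext => x /=; ring.
have hV : fine (sq_integral (v n)) <= C * fine (sq_integral (partial true (v n))).
  rewrite -lee_fin EFinM !sq_integral_fineK//.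
  apply: poincare_test_function => //; first by have [] := tv n.
  by move=> x Bx; apply: test_function_eq0 (tv n) _ => /hB; rewrite ltNge Bx.
have f0 f : 0 <= fine (sq_integral f) by rewrite fine_ge0// sq_integral_ge0.
move=> /andP[b10 b1e] /andP[b00 b0e] /andP[a0 ae] E.
have He : K * (3 * e1) = e.
  by rewrite /e1; field; rewrite gt_eqF.
apply: le_trans (spectral_gap_estimate C0 nuc hU hV _ _ _ _ _ b10 b00 a0 E) _; try exact: f0.
rewrite -He (_ : 3 * e1 = e1 + e1 + e1); last by ring.
apply: ler_wpM2l; first exact: ltW.
by apply: lerD => //; exact: lerD.
Qed.

End SpectralGap.

(** * Multiplicities *)

Section Multiplicity.
Context {R : realType}.
Implicit Types (u f h : plane R -> R) (A B M : set (plane R)) (nu : R).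
Local Notation mplane := (measurableTypeR R * measurableTypeR R)%type.

Definition free_family M nu (n : nat) := exists u : 'I_n -> plane R -> R,
  (forall i, dirichlet_eigenspace M nu (u i)) /\ ae_free u.

Lemma ae_plane_forall n (P : 'I_n -> plane R -> Prop) :
  (forall i, {ae leb2 R, forall x, P i x}) -> {ae leb2 R, forall x, forall i, P i x}.
Proof.
have F : Filter (almost_everywhere (leb2 R)) := ae_filter_ringOfSetsType _.
exact: (@filter_forall _ _ _ _ F).
Qed.

Lemma free_family0 M nu : free_family M nu 0.
Proof. by exists (fun _ _ => 0); split => [[]//|a _ []]. Qed.

Lemma free_familyS M nu n : free_family M nu n.+1 -> free_family M nu n.
Proof.
move=> [u [hu fu]]; exists (fun i => u (lift ord0 i)); split => [i|a ha i]; first exact: hu.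
pose a' (i : 'I_n.+1) := oapp a 0 (unlift ord0 i).
have := fu a' _ (lift ord0 i); rewrite /a' liftK /=; apply.
apply: ae_plane_mono ha => x hx; rewrite big_ord_recl /a' unlift_none mul0r add0r -[RHS]hx.
by apply: eq_bigr => j _; rewrite liftK.
Qed.

Lemma free_family_leq M nu m n : (m <= n)%N -> free_family M nu n -> free_family M nu m.
Proof.
move=> /subnK <-; elim: (n - m)%N => [//|k IH]; rewrite addSn => /free_familyS; exact: IH.
Qed.

Variant multiplicity_spec M nu : \bar R -> Prop :=
| MultiplicityInfinite of (forall n, free_family M nu n) : multiplicity_spec M nu +oo%E
| MultiplicityFinite k of free_family M nu k & (forall n, free_family M nu n -> (n <= k)%N) :
    multiplicity_spec M nu k%:R%:E.

Lemma multiplicityP M nu : multiplicity_spec M nu (multiplicity M nu).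
Proof.
have ub n : free_family M nu n -> ((n%:R)%:E <= multiplicity M nu)%E.
  by move=> fn; apply: ereal_sup_ubound; exists n.
have [all|/existsNP[n nfn]] := pselect (forall n, free_family M nu n).
  suff -> : multiplicity M nu = +oo%E by exact: MultiplicityInfinite.
  apply/eqyP => r r0; apply: le_trans (ub _ (all (Num.truncn r).+1)).
  by rewrite lee_fin ltW// truncnS_gt.
have bd m : free_family M nu m -> (m <= n)%N.
  move=> fm; rewrite leqNgt; apply/negP => nm; apply: nfn.
  exact: free_family_leq (ltnW nm) fm.
have ex : exists m, `[< free_family M nu m >] by exists 0%N; apply/asboolP; exact: free_family0.
have bd' m : `[< free_family M nu m >] -> (m <= n)%N by move=> /asboolP; exact: bd.
case: (ex_maxnP ex bd') => k /asboolP fk hk.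
suff -> : multiplicity M nu = k%:R%:E.
  by apply: MultiplicityFinite => // m fm; apply: hk; exact/asboolP.
apply/eqP; rewrite eq_le ub// andbT; apply: ub_ereal_sup => _ [m /= fm <-].
by rewrite lee_fin ler_nat; apply: hk; apply/asboolP.
Qed.

Lemma multiplicity_ge0 M nu : (0 <= multiplicity M nu)%E.
Proof. by case: multiplicityP => // k _ _; rewrite lee_fin. Qed.

Lemma multiplicity_eq0 M nu : (forall u, dirichlet_eigenspace M nu u ->
  {ae leb2 R, forall x, u x = 0}) -> multiplicity M nu = 0%E.
Proof.
move=> h0.
have no : ~ free_family M nu 1.
  move=> [u [hu fu]]; have := fu (fun=> 1) _ ord0; apply/not_implyP; split => [|/eqP].
    by apply: ae_plane_mono (h0 _ (hu ord0)) => x ux; rewrite big_ord_recl big_ord0 ux mulr0 addr0.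
  by rewrite oner_eq0.
case: multiplicityP => [/(_ 1%N)//|k fk _]; suff -> : k = 0%N by [].
apply/eqP; rewrite -leqn0 leqNgt; apply/negP => k0; apply: no; exact: free_family_leq fk.
Qed.

Lemma ae_comp_similarity S k (P : plane R -> Prop) : similarity S k ->
  {ae leb2 R, forall x, P (S x)} -> {ae leb2 R, forall x, P x}.
Proof.
move=> sS; have [S' [sS' c1 c2]] := similarity_inv sS.
have [k' [k0 mS' hS']] := similarity_measure_scaling sS'.
move=> [N [mN N0 hN]]; exists (S' @^-1` N); split.
- by rewrite -[X in measurable X]setTI; exact: mS'.
- by rewrite hS'// N0 mule0.
- by move=> x nPx; apply: hN => /=; rewrite c2.
Qed.

Lemma free_family_similarity S k M nu n : similarity S k ->
  free_family (S @` M) nu n -> free_family M (k * nu) n.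
Proof.
move=> sS [u [hu fu]]; exists (fun i => u i \o S); split => [i|a ha].
  exact: eigenspace_comp (hu i).
by apply: fu; apply: (ae_comp_similarity sS).
Qed.

Lemma multiplicity_similarity S k M nu : similarity S k ->
  multiplicity (S @` M) nu = multiplicity M (k * nu).
Proof.
move=> sS; have [S' [sS' c1 c2]] := similarity_inv sS.
rewrite /multiplicity; congr ereal_sup; congr image; apply/seteqP; split => n.
  exact: free_family_similarity.
have k0 : k != 0 by have [k0 _] := sS; rewrite gt_eqF.
have E : S' @` (S @` M) = M.
  rewrite image_comp; apply/seteqP; split => [_ [x Mx <-]|x Mx]; first by rewrite /= c1.
  by exists x => //=; rewrite c1.
rewrite -{1}E => /(free_family_similarity sS').
by rewrite mulrA mulVf// mul1r.
Qed.

End Multiplicity.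

(** * Additivity of multiplicities over two disjoint open sets *)

Section Additivity.
Context {R : realType}.
Implicit Types (u f h : plane R -> R) (A B M : set (plane R)) (nu : R).
Local Notation mplane := (measurableTypeR R * measurableTypeR R)%type.

(** Adjoining [w] to a free family of maximal size creates a nontrivial relation, in which the
    coefficient of [w] cannot be zero because [e] is free. *)
Lemma free_family_span M nu k (e : 'I_k -> plane R -> R) w :
  (forall n, free_family M nu n -> (n <= k)%N) ->
  (forall i, dirichlet_eigenspace M nu (e i)) -> ae_free e ->
  dirichlet_eigenspace M nu w ->
  exists c : 'I_k -> R, {ae leb2 R, forall x, w x = \sum_(j < k) c j * e j x}.
Proof.
move=> kmax he fe hw.
pose e' (i : 'I_k.+1) := oapp e w (unlift ord0 i).
have : ~ ae_free e'.
  move=> fe'; have := kmax k.+1; rewrite ltnn; apply/not_implyP; split=> //.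
  exists e'; split => // i; rewrite /e'; case: unlift => [j|]; [exact: he|exact: hw].
move=> /existsNP[a /not_implyP[ha na]].
have {}ha : {ae leb2 R, forall x, a ord0 * w x + \sum_(j < k) a (lift ord0 j) * e j x = 0}.
  apply: ae_plane_mono ha => x; rewrite big_ord_recl {1}/e' unlift_none /= => hx.
  by rewrite -[RHS]hx; congr (_ + _); apply: eq_bigr => j _; rewrite /e' liftK.
have a0 : a ord0 != 0.
  apply/eqP => a0; apply: na => i.
  have a1 : forall j, a (lift ord0 j) = 0.
    by apply: fe; apply: ae_plane_mono ha => x; rewrite a0 mul0r add0r.
  by case: (unliftP ord0 i) => [j ->|->].
exists (fun j => - a (lift ord0 j) / a ord0).
apply: ae_plane_mono ha => x /eqP; rewrite addr_eq0 => /eqP hx.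
rewrite -[LHS](mulKf a0) hx -sumrN mulr_sumr; apply: eq_bigr => j _.
by rewrite mulrC !mulNr mulrAC.
Qed.

(** On [A] the second family vanishes almost everywhere, so a relation reduces there to one of the
    first family; once those coefficients are zero, a relation of the second family is left. *)
Lemma free_family_setU A B nu m n : open A -> open B -> A `&` B = set0 ->
  free_family A nu m -> free_family B nu n -> free_family (A `|` B) nu (m + n).
Proof.
move=> oA oB AB0 [u [hu fu]] [v [hv fv]].
exists (fun i : 'I_(m + n) => match fintype.split i with inl j => u j | inr j => v j end); split.
  move=> i; case: fintype.split => j; first exact: eigenspace_setU.
  by rewrite setUC; apply: eigenspace_setU; rewrite 1?setIC.
move=> a ha.
have {}ha : {ae leb2 R, forall x, \sum_(j < m) a (lshift n j) * u j x +
    \sum_(j < n) a (rshift m j) * v j x = 0}.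
  apply: ae_plane_mono ha => x; rewrite big_split_ord /= => hx; rewrite -[RHS]hx.
  congr (_ + _); apply: eq_bigr => j _.
    by rewrite (unsplitK (inl _ j)).
  by rewrite (unsplitK (inr _ j)).
have u0 := ae_plane_forall (fun j => eigenspace_eq0 oA (hu j)).
have v0 := ae_plane_forall (fun j => eigenspace_eq0 oB (hv j)).
have H := ae_plane_and ha (ae_plane_and u0 v0).
have aA : forall j, a (lshift n j) = 0.
  apply: (fu (fun j => a (lshift n j))).
  apply: ae_plane_mono H => x [hx [ux vx]].
  have [Ax|nAx] := pselect (A x).
    rewrite -[RHS]hx [X in _ = _ + X]big1 ?addr0// => j _; rewrite vx ?mulr0// => Bx.
    by have : (A `&` B) x by []; rewrite AB0.
  by rewrite big1// => j _; rewrite ux ?mulr0.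
have aB : forall j, a (rshift m j) = 0.
  apply: (fv (fun j => a (rshift m j))).
  apply: ae_plane_mono ha => x hx; rewrite -[RHS]hx [X in _ = X + _]big1 ?add0r// => j _.
  by rewrite aA mul0r.
move=> i; rewrite -(splitK i); case: fintype.split => j /=; [exact: aA|exact: aB].
Qed.

(* Expand the restrictions of the u i to A and to B in bases of the two
   eigenspaces: the n x (k + l) matrix of coefficients has a left kernel if
   n > k + l. *)
Lemma free_family_setU_le A B nu k l n : open A -> open B -> A `&` B = set0 ->
  free_family A nu k -> (forall n, free_family A nu n -> (n <= k)%N) ->
  free_family B nu l -> (forall n, free_family B nu n -> (n <= l)%N) ->
  free_family (A `|` B) nu n -> (n <= k + l)%N.
Proof.
move=> oA oB AB0 [e [he fe]] kmax [f [hf ff]] lmax [u [hu fu]].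
have BA0 : B `&` A = set0 by rewrite setIC.
have huA i : dirichlet_eigenspace A nu (restrict A (u i)) by exact: eigenspace_restrict (hu i).
have huB i : dirichlet_eigenspace B nu (restrict B (u i)).
  by apply: (eigenspace_restrict oB oA BA0); rewrite setUC; exact: hu.
have [c hc] := choice (fun i => free_family_span kmax he fe (huA i)).
have [d hd] := choice (fun i => free_family_span lmax hf ff (huB i)).
rewrite leqNgt; apply/negP => nkl.
pose C : 'M[R]_(n, k + l) := row_mx (\matrix_(i, j) c i j) (\matrix_(i, j) d i j).
have : kermx C != 0.
  rewrite kermx_eq0 /row_free; apply: contraL nkl => /eqP <-.
  by rewrite -leqNgt rank_leq_col.
move=> /rowV0Pn[v /sub_kermxP vC /negP]; apply.
move: vC; rewrite mul_mx_row -[RHS]row_mx0 => /eq_row_mx[vc vd].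
apply/eqP/rowP => i; rewrite mxE.
apply: (fu (fun i => v 0 i)) => {i}.
have oAB : open (A `|` B) by exact: openU.
have H := ae_plane_and (ae_plane_forall (fun i => eigenspace_eq0 oAB (hu i)))
  (ae_plane_and (ae_plane_forall hc) (ae_plane_forall hd)).
have Z p (m : 'I_n -> 'I_p -> R) (g : 'I_p -> plane R -> R) x :
    v *m (\matrix_(i, j) m i j) = 0 ->
    \sum_(i < n) v 0 i * \sum_(j < p) m i j * g j x = 0.
  move=> vM; under eq_bigr do rewrite mulr_sumr.
  rewrite exchange_big /= big1// => j _; under eq_bigr do rewrite mulrA.
  rewrite -mulr_suml; have /rowP /(_ j) := vM; rewrite !mxE.
  by under eq_bigr do rewrite mxE; move=> ->; rewrite mul0r.
apply: ae_plane_mono H => x [u0 [ucA ucB]].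
have uE i : u i x = restrict A (u i) x + restrict B (u i) x.
  rewrite /restrict !indicE.
  have [Ax|nAx] := pselect (A x).
    rewrite mem_set// memNset ?mul1r ?mul0r ?addr0// => Bx.
    by have : (A `&` B) x by []; rewrite AB0.
  rewrite [_ \in A]memNset// mul0r add0r.
  have [Bx|nBx] := pselect (B x); first by rewrite mem_set// mul1r.
  by rewrite u0 ?mulr0// => -[].
under eq_bigr do rewrite uE ucA ucB mulrDr.
rewrite big_split /=.
by rewrite (Z _ _ e x vc) (Z _ _ f x vd) addr0.
Qed.

(** If one multiplicity is infinite, families of any size on that piece, joined with the empty
    family of the other, make the total infinite. Otherwise the lower and upper bounds on the size
    of free families meet. *)
Lemma multiplicity_setU A B nu : open A -> open B -> A `&` B = set0 ->
  multiplicity (A `|` B) nu = (multiplicity A nu + multiplicity B nu)%E.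
Proof.
move=> oA oB AB0.
have F m n := @free_family_setU A B nu m n oA oB AB0.
have [allA|k fk kmax] := multiplicityP A nu.
  rewrite addye ?gt_eqF// ?(lt_le_trans _ (multiplicity_ge0 _ _))//.
  case: multiplicityP => // k fk kmax.
  have := kmax (k.+1 + 0)%N (F _ _ (allA _) (free_family0 _ _)).
  by rewrite addn0 ltnn.
have [allB|l fl lmax] := multiplicityP B nu.
  rewrite addey//.
  case: multiplicityP => // n fn nmax; have := nmax (0 + n.+1)%N (F _ _ (free_family0 _ _) (allB _)).
  by rewrite add0n ltnn.
rewrite -EFinD -natrD.
case: multiplicityP => [all|n fn nmax].
  have := free_family_setU_le oA oB AB0 fk kmax fl lmax (all (k + l).+1).
  by rewrite ltnn.
suff -> : n = (k + l)%N by [].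
apply/eqP; rewrite eqn_leq nmax ?andbT; last exact: F.
exact: (free_family_setU_le oA oB AB0 fk kmax fl lmax fn).
Qed.

End Additivity.

(** * Countable disjoint unions whose spectral gaps [r j] tend to infinity *)

Section CountableUnion.
Context {R : realType}.
Variables (M : nat -> set (plane R)) (r : nat -> R).
Hypothesis oM : forall j, open (M j).
Hypothesis tM : trivIset [set: nat] M.
Hypothesis rM : forall j nu u, nu < r j -> dirichlet_eigenspace (M j) nu u ->
  {ae leb2 R, forall x, u x = 0}.
Hypothesis r_oo : forall nu, exists k, forall j, (k <= j)%N -> nu < r j.

Let U k := \bigcup_(j in [set j | (k <= j)%N]) M j.

Let open_sub (J : set nat) : open (\bigcup_(j in J) M j).
Proof. by apply: bigcup_open => j _; exact: oM. Qed.

Let disj j (J : set nat) : ~ J j -> M j `&` \bigcup_(i in J) M i = set0.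
Proof.
move=> nJ; apply/seteqP; split => // x [Mjx [i Ji Mix]].
by apply: nJ; rewrite (@tM j i I I) //; exists x.
Qed.

Let U_split k : U k = M k `|` U k.+1.
Proof.
apply/seteqP; split => [x [j /= kj Mjx]|x [Mkx|[j /= kj Mjx]]].
- move: kj; rewrite leq_eqVlt => /predU1P[->|kj]; first by left.
  by right; exists j.
- by exists k => /=.
- by exists j => //=; exact: ltnW.
Qed.

Let mult_split nu k : multiplicity (U 0) nu =
  (\sum_(0 <= j < k) multiplicity (M j) nu + multiplicity (U k) nu)%E.
Proof.
elim: k => [|k IH]; first by rewrite big_geq// add0e.
rewrite IH big_nat_recr//= -addeA; congr (_ + _)%E.
rewrite {1}U_split multiplicity_setU//; first exact: open_sub.
by apply: disj => /=; rewrite ltnn.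
Qed.

(** For each [j >= k] the tail is [M j] together with a disjoint open rest, so an eigenfunction on
    the tail restricts to one on [M j] at a level below [r j], hence to zero. Countably many null
    sets are discarded. *)
Let mult_tail nu k : (forall j, (k <= j)%N -> nu < r j) -> multiplicity (U k) nu = 0%E.
Proof.
move=> hk; apply: multiplicity_eq0 => u hu.
have h0 := eigenspace_eq0 (@open_sub _) hu.
have hj j : {ae leb2 R, forall x, (k <= j)%N -> M j x -> u x = 0}.
  have [kj|jk] := leqP k j; last first.
    by apply: ae_plane_mono h0 => x _ //.
  have UE : U k = M j `|` \bigcup_(i in [set i | (k <= i)%N /\ i <> j]) M i.
    apply/seteqP; split => [x [i /= ki Mix]|x [Mjx|[i /= [ki _] Mix]]].
    - have [<-|/eqP ij] := eqVneq i j; first by left.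
      by right; exists i.
    - by exists j.
    - by exists i.
  have d : M j `&` \bigcup_(i in [set i | (k <= i)%N /\ i <> j]) M i = set0.
    by apply: disj => /= -[_].
  move: hu; rewrite UE => /(eigenspace_restrict (@oM j) (@open_sub _) d).
  move=> /(rM (hk _ kj)); apply: ae_plane_mono => x + _ Mjx.
  by rewrite /restrict indicE mem_set// mul1r.
have /ae_foralln {}hj := hj.
have H := ae_plane_and h0 hj.
apply: ae_plane_mono H => x [x0 xj].
have [[j /= kj Mjx]|nU] := pselect (U k x); first exact: (xj j).
exact: x0.
Qed.

(** At level [nu] only finitely many pieces contribute, so both sides equal the same finite sum. *)
Lemma multiplicity_bigcup nu : multiplicity (\bigcup_(j in [set: nat]) M j) nu =
  (\sum_(0 <= j <oo) multiplicity (M j) nu)%E.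
Proof.
have -> : \bigcup_(j in [set: nat]) M j = U 0.
  by apply/seteqP; split => x [j _ Mjx]; exists j.
have [k hk] := r_oo nu.
rewrite (mult_split nu k) mult_tail// adde0.
rewrite (nneseries_split 0 k); last by move=> j _; exact: multiplicity_ge0.
rewrite add0n [X in (_ + X)%E]eseries0 ?adde0// => j kj _.
by apply: multiplicity_eq0 => u; apply: rM; exact: hk.
Qed.

End CountableUnion.

(** * Heat traces as spectral integrals *)

Section HeatTrace.
Context {R : realType}.
Implicit Types (M : set (plane R)) (nu mu t : R).
Local Notation leb := (@lebesgue_measure R).

(** Extended natural numbers. Integrality turns [j < y] into [j + 1 <= y] and makes [y] the number
    of [j] with [j + 1 <= y], which is how counts are converted into sums over eigenvalue
    indices. *)
Definition is_enat (y : \bar R) := y = +oo%E \/ exists k : nat, y = k%:R%:E.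

Lemma multiplicity_enat M nu : is_enat (multiplicity M nu).
Proof. by case: multiplicityP => [_|k _ _]; [left|right; exists k]. Qed.

Lemma is_enatD x y : is_enat x -> is_enat y -> is_enat (x + y)%E.
Proof.
move=> [->|[k ->]] [->|[l ->]]; try by left.
by right; exists (k + l)%N; rewrite natrD.
Qed.

Lemma is_enat_fsum (I : choiceType) (F : set I) (a : I -> \bar R) : finite_set F ->
  (forall i, is_enat (a i)) -> is_enat (\sum_(i \in F) a i)%E.
Proof.
move=> fF ha; rewrite fsbig_finite//=; apply: (big_ind is_enat) => //.
  by right; exists 0%N.
exact: is_enatD.
Qed.

Lemma is_enat_lt (j : nat) y : is_enat y -> (j%:R%:E < y)%E = (j.+1%:R%:E <= y)%E.
Proof.
move=> [->|[k ->]]; first by rewrite ltry leey.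
by rewrite lte_fin lee_fin ltr_nat ler_nat.
Qed.

Lemma is_enat_sup (S : set (\bar R)) : S !=set0 -> (forall y, S y -> is_enat y) ->
  is_enat (ereal_sup S).
Proof.
move=> [y0 Sy0] hS.
have [all|/existsNP[n hn]] := pselect (forall n : nat, exists2 y, S y & (n%:R%:E <= y)%E).
  left; apply/eqyP => r r0; have [y Sy hy] := all (Num.truncn r).+1.
  apply: le_trans (ereal_sup_ubound Sy); apply: le_trans hy.
  by rewrite lee_fin ltW// truncnS_gt.
have hk y : S y -> exists2 k, y = k%:R%:E & (k <= n)%N.
  move=> Sy; have [yoo|[k yk]] := hS _ Sy.
    by exfalso; apply: hn; exists y => //; rewrite yoo leey.
  exists k => //; rewrite leqNgt; apply/negP => nk; apply: hn; exists y => //.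
  by rewrite yk lee_fin ler_nat ltnW.
have ex : exists k, `[< S k%:R%:E >].
  by have [k yk _] := hk _ Sy0; exists k; apply/asboolP; rewrite -yk.
have bd k : `[< S k%:R%:E >] -> (k <= n)%N.
  move=> /asboolP /hk[l + ln] => -[] /eqP; rewrite eqr_nat => /eqP ->.
  exact: ln.
case: (ex_maxnP ex bd) => k /asboolP Sk kmax; right; exists k.
apply/eqP; rewrite eq_le ereal_sup_ubound// andbT.
apply: ge_ereal_sup => y Sy; have [l yl _] := hk _ Sy.
by rewrite yl lee_fin ler_nat; apply: kmax; apply/asboolP; rewrite -yl.
Qed.

Lemma enat_series (K : \bar R) : is_enat K ->
  (\sum_(0 <= j <oo) ((j.+1%:R%:E <= K)%E : bool)%:R%:E = K)%E.
Proof.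
have sumT n : (\sum_(0 <= j < n) (1%:E : \bar R) = n%:R%:E)%E.
  by rewrite sumEFin big_const_nat subn0 iter_addr addr0.
have ge0 j : (0 <= ((j.+1%:R%:E <= K)%E : bool)%:R%:E :> \bar R)%E by rewrite lee_fin ler0n.
move=> [KE|[k KE]]; rewrite KE in ge0 *.
  apply/eqyP => r r0; apply: (@le_trans _ _ ((Num.truncn r).+1%:R%:E)).
    by rewrite lee_fin ltW// truncnS_gt.
  apply: le_trans (nneseries_lim_ge (Num.truncn r).+1 (fun j _ _ => ge0 j)).
  rewrite -sumT; apply: lee_sum => j _.
  by rewrite leey.
rewrite (nneseries_split 0 k); last by move=> j _; exact: ge0.
rewrite add0n eseries0 ?adde0; last first.
  by move=> j kj _; rewrite lee_fin ler_nat ltnNge kj.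
rewrite -[RHS]sumT; apply: eq_big_nat => j /andP[_ jk].
by rewrite lee_fin ler_nat jk.
Qed.

(** The strict bound matches [dirichlet_eigenvalue M j < x] exactly, even if the infimum defining
    the eigenvalue is not attained. *)
Definition count_below M x : \bar R := \esum_(nu in [set nu : R | nu < x]) multiplicity M nu.

Lemma count_below_enat M x : is_enat (count_below M x).
Proof.
apply: is_enat_sup; first by eexists; exists set0 => //; exact: fsets_set0.
by move=> _ [F [fF _] <-]; apply: is_enat_fsum => // nu; exact: multiplicity_enat.
Qed.

Lemma finite_set_lt_ub (F : set R) x : finite_set F -> (forall nu, F nu -> nu < x) ->
  exists2 mu, mu < x & forall nu, F nu -> nu <= mu.
Proof.
move=> /finite_seqP[s ->]; elim: s => [_|a s IH h].
  by exists (x - 1) => //; rewrite ltrBlDr ltrDl.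
have [|mu mux hmu] := IH; first by move=> nu nus; apply: h; rewrite /= inE nus orbT.
exists (Num.max a mu).
  by rewrite gt_max mux h//= inE eqxx.
move=> nu /=; rewrite inE le_max => /predU1P[->|/hmu ->]; first by rewrite lexx.
by rewrite orbT.
Qed.

(** If the count below [x] exceeds [j], it does so on a finite set of levels, and these lie below
    some [mu < x], which witnesses the strict inequality for the infimum. *)
Lemma dirichlet_eigenvalue_lt M j x : (dirichlet_eigenvalue M j < x%:E)%E =
  (j.+1%:R%:E <= count_below M x)%E.
Proof.
apply/idP/idP.
  move=> /ereal_inf_lt[_ [mu /= hmu <-]]; rewrite lte_fin => mux.
  apply: le_trans hmu _; apply: ge_ereal_sup => _ [F [fF FS] <-].
  apply: ereal_sup_ubound; exists F => //; split => // nu /FS /= numu.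
  exact: le_lt_trans mux.
rewrite -is_enat_lt; last exact: count_below_enat.
move=> /ereal_sup_gt[_ [F [fF FS] <-]] hF.
have [mu mux hmu] := finite_set_lt_ub fF FS.
apply: (@le_lt_trans _ _ mu%:E); last by rewrite lte_fin.
apply: ereal_inf_lbound; exists mu => //=.
rewrite is_enat_lt in hF; last first.
  by apply: is_enat_fsum => // nu; exact: multiplicity_enat.
by apply: esum_ge; exists F => //; split.
Qed.

Lemma expeR_gt (s : R) t (y : \bar R) : 0 < s -> 0 < t ->
  (s%:E < expeR (- (t%:E * y)))%E = (y < (- ln s / t)%:E)%E.
Proof.
move=> s0 t0; case: y => [y| |].
- rewrite -EFinM /= !lte_fin -{1}(lnK s0) ltr_expR ltrNr ltr_pdivlMr// mulrC.
  by [].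
- rewrite gt0_muley; last by rewrite lte_fin.
  by rewrite /= lte_fin ltNge (ltW s0).
- rewrite gt0_muleNy; last by rewrite lte_fin.
  by rewrite /= ltry ltNyr.
Qed.

(* Layer cake: exp (- t lambda) is the length of the s in ]0, exp (- t lambda)[,
   i.e. of those s > 0 such that lambda < - ln s / t.  This makes the heat trace
   linear in the multiplicities without assuming a discrete spectrum. *)
Lemma heat_trace_layer M t : 0 < t -> heat_trace M t =
  (\int[leb]_(s in `]0%R, +oo[) count_below M (- ln s / t)%R)%E.
Proof.
move=> t0; pose A j : set R := [set s | (s%:E < expeR (- (t%:E * dirichlet_eigenvalue M j)))%E].
have mA j : measurable (A j : set (measurableTypeR R)).
  by apply: open_measurable; exact: open_ereal_lt.
transitivity (\sum_(0 <= j <oo) \int[leb]_(s in `]0%R, +oo[) (\1_(A j) s)%:E)%E.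
  apply: eq_eseriesr => j _; rewrite integral_indic//.
  rewrite /A; case E : (expeR _) => [e| |].
  - transitivity (leb (`]0%R, e[%classic : set R)); last first.
      congr (leb _); apply/seteqP; split => s; rewrite /= !in_itv/= lte_fin ?andbT.
        by move=> /andP[].
      by move=> [-> ->].
    rewrite lebesgue_measure_itv/= lte_fin sube0.
    have := expeR_ge0 (- (t%:E * dirichlet_eigenvalue M j)); rewrite E lee_fin.
    by rewrite le_eqVlt => /predU1P[<-|->]//; rewrite ltxx.
  - transitivity (leb (`]0%R, +oo[%classic : set R)); last first.
      by congr (leb _); apply/seteqP; split => s; rewrite /= !in_itv/= ltry ?andbT// => -[].
    by rewrite lebesgue_measure_itv/= ltry.
  - by have := expeR_ge0 (- (t%:E * dirichlet_eigenvalue M j)); rewrite E.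
rewrite -integral_nneseries//; last first.
  by move=> j; apply/measurable_EFinP; exact: measurable_indic.
apply: eq_integral => s; rewrite inE/= in_itv/= andbT => s0.
rewrite -[RHS](enat_series (count_below_enat _ _)); apply: eq_eseriesr => j _.
rewrite indicE -dirichlet_eigenvalue_lt -expeR_gt//.
by congr ((nat_of_bool _)%:R%:E); rewrite /A; apply/idP/idP => [/[!inE]//|?]; rewrite inE.
Qed.

Lemma measurable_count_below M t : 0 < t ->
  measurable_fun (`]0%R, +oo[%classic : set (measurableTypeR R)) (fun s : measurableTypeR R => count_below M (- ln s / t)%R).
Proof.
move=> t0; pose A j : set R := [set s | (s%:E < expeR (- (t%:E * dirichlet_eigenvalue M j)))%E].
apply: (@eq_measurable_fun _ _ _ _ _ (fun s => \sum_(0 <= j <oo) (\1_(A j) s)%:E)%E).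
  move=> s; rewrite inE/= in_itv/= andbT => s0.
  rewrite -[RHS](enat_series (count_below_enat _ _)); apply: eq_eseriesr => j _.
  rewrite indicE -dirichlet_eigenvalue_lt -expeR_gt//.
  by congr ((nat_of_bool _)%:R%:E); rewrite /A; apply/idP/idP => [/[!inE]//|?]; rewrite inE.
apply: ge0_emeasurable_sum => // j _; apply/measurable_EFinP.
by apply: measurable_indic; apply: open_measurable; exact: open_ereal_lt.
Qed.

(** In layer-cake form all terms are nonnegative and linear in the multiplicities, so the sum over
    the pieces can be exchanged with the sum over the levels and with the integral. *)
Lemma heat_trace_bigcup (M : nat -> set (plane R)) U t : 0 < t ->
  (forall nu, multiplicity U nu = (\sum_(0 <= j <oo) multiplicity (M j) nu)%E) ->
  heat_trace U t = (\sum_(0 <= j <oo) heat_trace (M j) t)%E.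
Proof.
move=> t0 hU; rewrite heat_trace_layer//.
under [RHS]eq_eseriesr do rewrite heat_trace_layer//.
rewrite -integral_nneseries//; last 2 first.
- by move=> j; exact: measurable_count_below.
- by move=> j s _; apply: esum_ge0 => nu _; exact: multiplicity_ge0.
apply: eq_integral => s _; rewrite /count_below.
have m0 j nu : (0 <= multiplicity (M j) nu)%E by exact: multiplicity_ge0.
under eq_esum do rewrite hU nneseries_esumT//.
rewrite [RHS]nneseries_esumT; last by move=> j; apply: esum_ge0.
rewrite esum_esum// esum_esum//.
rewrite (reindex_esum ([set: nat] `*` [set nu | nu < - ln s / t]) _ (fun x => (x.2, x.1)))//.
split => //=; first by move=> [i j] [/=].
  by move=> [i1 i2] [j1 j2] /= _ _ [] -> ->.
by move=> [i1 i2] [Pi1 Qi2] /=; exists (i2, i1).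
Qed.

Lemma heat_trace_scale M N (k : R) t : 0 < t -> 0 < k ->
  (forall nu, multiplicity N nu = multiplicity M (k * nu)) ->
  heat_trace N t = heat_trace M (t / k).
Proof.
move=> t0 k0 hN; have tk0 : 0 < t / k by rewrite divr_gt0.
rewrite (heat_trace_layer _ t0) (heat_trace_layer _ tk0); apply: eq_integral => s _.
have kn0 : k != 0 by rewrite gt_eqF.
rewrite /count_below (reindex_esum [set nu | nu < - ln s / t]
  [set nu | nu < - ln s / (t / k)] (fun nu => k * nu) (multiplicity M)).
  by apply: eq_esum => nu _; exact: hN.
have E : - ln s / (t / k) = k * (- ln s / t) by rewrite invf_div mulrA mulrAC mulrC mulrA.
split.
- by move=> nu /= h; rewrite E ltr_pM2l.
- by move=> x y _ _; exact: mulfI.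
- move=> nu /=; rewrite E => h; exists (k^-1 * nu); last by rewrite mulrA divff// mul1r.
  by rewrite /= ltr_pdivrMl.
Qed.

End HeatTrace.

(** * The expansion *)

Section PeriodicExpansion.
Context {R : realType}.
Implicit Types (u v : nat -> R).

Lemma series_geometric_dominated u (K q : R) : 0 <= q -> q < 1 ->
  (forall n, `|u n| <= K * q ^+ n) ->
  exists2 l : R, series u @ \oo --> l & `|l| <= K / (1 - q).
Proof.
move=> q0 q1 hu; have K0 : 0 <= K.
  by have := hu 0%N; rewrite expr0 mulr1; apply: le_trans.
have nq : `|q| < 1 by rewrite ger0_norm.
have cg := @cvg_geometric_series R K q nq.
have cn : cvgn [normed series u].
  apply: (@series_le_cvg _ (fun n => `|u n|) (geometric K q)) => //.
    by move=> n; exact: geometric_ge0.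
  by apply/cvg_ex; eexists; exact: cg.
exists (limn (series u)); first exact: normed_cvg.
apply: le_trans (lim_series_norm cn) _; rewrite -(cvg_lim _ cg)//.
apply: lim_series_le => //; apply/cvg_ex; eexists; exact: cg.
Qed.

Lemma series_cvg_shift u l : series u @ \oo --> l ->
  series (fun n => u n.+1) @ \oo --> l - u 0%N.
Proof.
move=> ul; have -> : series (fun n => u n.+1) = (fun n => [sequence series u n.+1]_n n - u 0%N).
  by apply/funext => n /=; rewrite !seriesEnat/= big_nat_recl// addrAC subrr add0r.
by apply: cvgB; [rewrite cvg_shiftS|exact: cvg_cst].
Qed.

Lemma series_cvgD u v k l : series u @ \oo --> k -> series v @ \oo --> l ->
  series (fun n => u n + v n) @ \oo --> k + l.
Proof. by move=> uk vl; rewrite (seriesD u v); exact: cvgD. Qed.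

(** Used with [x] proportional to [q ^- j], where it yields a geometric bound of ratio [q]. *)
Lemma expR_Nle_inv (x : R) : 0 < x -> expR (- x) <= x^-1.
Proof.
move=> x0; rewrite expRN lef_pV2 ?posrE ?expR_gt0//.
by apply: le_trans (expR_ge1Dx x); rewrite lerDr.
Qed.

(* Here vpi stands for pi; only its positivity matters. *)
Lemma periodic_expansion (Z : R -> R) (vpi A L V d1 d2 alpha : R) : 0 < alpha < 1 ->
  0 < vpi -> 0 < d1 -> 0 < d2 ->
  (forall s : R, 0 < s -> `|Z s - (A / (4 * vpi * s) - L / (8 * Num.sqrt (vpi * s)) + V)| <=
     d1 * expR (- (d2 / s))) ->
  (forall t : R, 0 < t -> exists K : R, forall j, `|Z (t / (alpha ^+ 2) ^+ j)| <= K * (alpha ^+ 2) ^+ j) ->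
  exists p : R -> R, (forall x : R, p (x + 2 * ln (alpha^-1)) = p x) /\
    exists C : R, forall t : R, 0 < t -> t <= 1 ->
      exists2 z : R, series (fun j => Z (t / (alpha ^+ 2) ^+ j)) @ \oo --> z &
        `|z - ((1 - alpha ^+ 2)^-1 * A / (4 * vpi * t) -
           (1 - alpha)^-1 * L / (8 * Num.sqrt (vpi * t)) + V / (2 * ln alpha) * ln t + p (ln t))| <=
        C * expR (- (d2 / (alpha ^+ 2 * t))).
Proof.
move=> /andP[a0 a1] vpi_gt0 d10 d20 hF hZ; set q := alpha ^+ 2.
have q0 : 0 < q by rewrite exprn_gt0.
have q1 : q < 1 by rewrite exprn_ilt1// ltW.
pose G s := Z s - A / (4 * vpi * s) + L / (8 * Num.sqrt (vpi * s)).
pose F s := G s - V.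
have FE (s : R) : 0 < s -> `|F s| <= d1 * expR (- (d2 / s)).
  by move=> /hF; rewrite /F /G; congr (`|_| <= _); ring.
have qj0 j : 0 < q ^+ j by rewrite exprn_gt0.
have sZ (t : R) : 0 < t -> exists z : R, series (fun j => Z (t / q ^+ j)) @ \oo --> z.
  move=> /hZ[K hK]; have [z hz _] := series_geometric_dominated (ltW q0) q1 hK.
  by exists z.
have sA (t : R) : 0 < t -> series (fun j => - (A / (4 * vpi * (t / q ^+ j)))) @ \oo -->
    - ((1 - q)^-1 * A / (4 * vpi * t)).
  move=> t0; have -> : (fun j => - (A / (4 * vpi * (t / q ^+ j)))) = geometric (- (A / (4 * vpi * t))) q.
    apply/funext => j /=.
    have qn : q ^+ j != 0 by rewrite gt_eqF.
    have tn : t != 0 by rewrite gt_eqF.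
    have pn : vpi != 0 by rewrite gt_eqF.
    by field; rewrite qn tn pn.
  rewrite (_ : - ((1 - q)^-1 * A / _) = - (A / (4 * vpi * t)) / (1 - q)); last by ring.
  by apply: cvg_geometric_series; rewrite ger0_norm ?ltW.
(* The square root makes the ratio of this series [alpha] instead of [q]. *)
have sL (t : R) : 0 < t -> series (fun j => L / (8 * Num.sqrt (vpi * (t / q ^+ j)))) @ \oo -->
    (1 - alpha)^-1 * L / (8 * Num.sqrt (vpi * t)).
  move=> t0; have -> : (fun j => L / (8 * Num.sqrt (vpi * (t / q ^+ j)))) =
      geometric (L / (8 * Num.sqrt (vpi * t))) alpha.
    apply/funext => j /=.
    have -> : Num.sqrt (vpi * (t / q ^+ j)) = Num.sqrt (vpi * t) / alpha ^+ j.
      rewrite mulrA sqrtrM; last by rewrite mulr_ge0 ?ltW.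
      by rewrite sqrtrV ?(ltW (qj0 j))// /q -exprM mulnC exprM sqrtr_sqr ger0_norm// exprn_ge0 ?ltW.
    have an : alpha ^+ j != 0 by rewrite expf_neq0// gt_eqF.
    have sn : Num.sqrt (vpi * t) != 0 by rewrite gt_eqF// sqrtr_gt0 mulr_gt0.
    by field; rewrite an sn.
  rewrite (_ : (1 - alpha)^-1 * L / _ = L / (8 * Num.sqrt (vpi * t)) / (1 - alpha)); last by ring.
  by apply: cvg_geometric_series; rewrite ger0_norm ?ltW.
have sG (t : R) : 0 < t -> exists l : R, series (fun j => G (t / q ^+ j)) @ \oo --> l.
  move=> t0; have [z hz] := sZ _ t0.
  by eexists; exact: series_cvgD (series_cvgD hz (sA _ t0)) (sL _ t0).
have sF (t : R) : 0 < t -> exists l : R, series (fun j => F (t * q ^+ j.+1)) @ \oo --> l.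
  move=> t0; have hd j : `|F (t * q ^+ j.+1)| <= (d1 * (t * q / d2)) * q ^+ j.
    apply: le_trans (FE _ _) _; first by rewrite mulr_gt0.
    rewrite -mulrA ler_pM2l//; apply: le_trans (expR_Nle_inv _) _.
      by rewrite divr_gt0// mulr_gt0.
    by rewrite invf_div exprS le_eqVlt; apply/orP; left; apply/eqP; ring.
  by have [l hl _] := series_geometric_dominated (ltW q0) q1 hd; exists l.
pose S0 t := limn (series (fun j => G (t / q ^+ j))).
pose S1 t := limn (series (fun j => F (t * q ^+ j.+1))).
have hS0 (t : R) : 0 < t -> series (fun j => G (t / q ^+ j)) @ \oo --> S0 t.
  by move=> /sG[l hl]; rewrite /S0 (cvg_lim _ hl).
have hS1 (t : R) : 0 < t -> series (fun j => F (t * q ^+ j.+1)) @ \oo --> S1 t.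
  by move=> /sF[l hl]; rewrite /S1 (cvg_lim _ hl).
have S0q (t : R) : 0 < t -> S0 (t / q) = S0 t - G t.
  move=> t0; apply: cvg_lim => //.
  have -> : (fun j => G (t / q / q ^+ j)) = (fun j => G (t / q ^+ j.+1)).
    by apply/funext => j; congr G; rewrite [q ^+ j.+1]exprS (invfM q) mulrA.
  by have := series_cvg_shift (hS0 _ t0); rewrite expr0 divr1.
have S1q (t : R) : 0 < t -> S1 t = S1 (t / q) - F t.
  move=> t0; apply: cvg_lim => //.
  have -> : (fun j => F (t * q ^+ j.+1)) = (fun j => F (t / q * q ^+ j.+2)).
    by apply/funext => j; congr F; rewrite [q ^+ j.+2]exprS mulrA divfK ?gt_eqF.
  by have := series_cvg_shift (hS1 _ (divr_gt0 t0 q0)); rewrite expr1 divfK ?gt_eqF.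
pose c := V / (2 * ln alpha).
exists (fun x => S0 (expR x) + S1 (expR x) - c * x); split => [x|].
  have la : ln alpha != 0 by rewrite lt_eqF// ln_lt0// a0.
  (* The period [2 * ln alpha^-1] equals [- ln q], so one period divides [t] by [q]. *)
  have -> : expR (x + 2 * ln alpha^-1) = expR x / q.
    rewrite expRD lnV ?posrE// mulrN expRN expRM_natl lnK ?posrE//.
  rewrite S0q ?expR_gt0// [in RHS]S1q ?expR_gt0// lnV ?posrE// /F /c.
  by field.
(* For [t <= 1] the exponent [d2 / (t q^(j+1))] exceeds [d2 / (q t)] by at least
   [w = (d2 / q) (q^-j - 1)], and [exp (- w) <= exp (d2 / q) (q / d2) q^j]. Summing over [j] gives
   the factor [1 / (1 - q)]. *)
exists (d1 * (q / d2) * expR (d2 / q) / (1 - q)) => t t0 t1.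
have [z hz] := sZ _ t0; exists z => //.
have zE : z = S0 t + (1 - q)^-1 * A / (4 * vpi * t) - (1 - alpha)^-1 * L / (8 * Num.sqrt (vpi * t)).
  have h := series_cvgD (series_cvgD hz (sA _ t0)) (sL _ t0).
  by rewrite /S0 (cvg_lim _ h)//; ring.
rewrite lnK ?posrE// zE -/c.
rewrite (_ : _ - _ = - S1 t); last by ring.
rewrite normrN.
have hd j : `|F (t * q ^+ j.+1)| <=
    (d1 * (q / d2) * expR (d2 / q) * expR (- (d2 / (q * t)))) * q ^+ j.
  apply: le_trans (FE _ _) _; first by rewrite mulr_gt0.
  pose w := d2 / q * (q ^- j - 1).
  have qV : 1 <= q ^- j by rewrite invf_ge1// exprn_ile1// ltW.
  have wge0 : 0 <= w by rewrite mulr_ge0 ?divr_ge0 ?subr_ge0// ltW.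
  have h1 : d2 / (q * t) + w <= d2 / (t * q ^+ j.+1).
    have -> : d2 / (t * q ^+ j.+1) = d2 / (q * t) + w / t.
      by rewrite /w exprS; field; rewrite !gt_eqF.
    by rewrite lerD2l ler_peMr// invf_ge1.
  have -> : d1 * (q / d2) * expR (d2 / q) * expR (- (d2 / (q * t))) * q ^+ j =
    d1 * ((d2 / q / q ^+ j)^-1 * (expR (d2 / q) * expR (- (d2 / (q * t))))).
    by rewrite !invf_div; ring.
  rewrite ler_pM2l//.
  apply: (@le_trans _ _ (expR (- (d2 / q / q ^+ j)) * (expR (d2 / q) * expR (- (d2 / (q * t)))))).
    rewrite -!expRD ler_expR; move: h1; rewrite /w mulrBr mulr1.
    move: (d2 / (t * _)) (d2 / (q * t)) (d2 / q / q ^+ j) (d2 / q) => x1 x2 x3 x4; lra.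
  rewrite ler_pM2r ?mulr_gt0 ?expR_gt0//; apply: expR_Nle_inv.
  by rewrite !divr_gt0.
have [l hl] := series_geometric_dominated (ltW q0) q1 hd.
rewrite /S1 (cvg_lim _ hl)// => /le_trans; apply.
by rewrite le_eqVlt; apply/orP; left; apply/eqP; ring.
Qed.

End PeriodicExpansion.

(** * Decay of the heat trace at large times *)

Section Decay.
Context {R : realType}.
Implicit Types (M : set (plane R)).

Lemma dirichlet_eigenvalue_ge M c j : (forall nu, nu < c -> multiplicity M nu = 0%E) ->
  (c%:E <= dirichlet_eigenvalue M j)%E.
Proof.
move=> h; rewrite leNgt dirichlet_eigenvalue_lt /count_below esum1//.
by rewrite lee_fin lern0.
Qed.

(** All eigenvalues are at least [c], so each term loses at least the factor [exp (- (s - t) c)]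
    between the times [t] and [s]; infinite eigenvalues contribute [0] at both. This supplies the
    decay along [t / q ^ j], where the short-time expansion gives none. *)
Lemma heat_trace_decay M c s t : 0 < t -> t <= s ->
  (forall nu, nu < c -> multiplicity M nu = 0%E) ->
  (heat_trace M s <= (expR (- ((s - t) * c)))%:E * heat_trace M t)%E.
Proof.
move=> t0 ts h; rewrite /heat_trace -nneseriesZl; last by move=> j _; exact: expeR_ge0.
apply: lee_nneseries => [j _ _|j _]; first exact: expeR_ge0.
have := dirichlet_eigenvalue_ge j h; case: (dirichlet_eigenvalue M j) => [y| |]//.
  rewrite lee_fin => cy; rewrite -!EFinM /= lee_fin -expRD ler_expR.
  have := ler_wpM2l (_ : 0 <= s - t) cy; rewrite subr_ge0 => /(_ ts); lra.
have s0 : 0 < s by exact: lt_le_trans ts.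
by rewrite !gt0_muley ?lte_fin//= mule0.
Qed.

End Decay.

Lemma divr_exprn_unbounded (R : realType) (q nu c : R) : 0 < q -> q < 1 -> 0 < c ->
  exists k, forall j, (k <= j)%N -> nu < c / q ^+ j.
Proof.
move=> q0 q1 c0; have [nu0|nu0] := leP nu 0.
  by exists 0%N => j _; apply: le_lt_trans nu0 _; rewrite divr_gt0// exprn_gt0.
have /cvgr0_norm_lt /(_ _ (divr_gt0 c0 nu0)) [k _ hk] : q ^+ n @[n --> \oo] --> 0.
  by apply: cvg_expr; rewrite ger0_norm// ltW.
exists k => j /hk /=; rewrite ger0_norm ?exprn_ge0 ?ltW//.
by rewrite !ltr_pdivlMr// ?exprn_gt0// mulrC.
Qed.

Theorem theorem12 (R : realType)
  (P : set (plane R)) (b : seq (seq (plane R))) (hP : polygon P b)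
  (alpha : R) (halpha : 0 < alpha < 1)
  (T : nat -> plane R -> plane R) (hT : forall j, euclidean_isometry (T j))
  (hdisj : trivIset [set: nat] (fun j => T j @` dilation (alpha ^+ j) P))
  (Palpha : set (plane R))
  (hPalpha : Palpha = \bigcup_(j in [set: nat]) (T j @` dilation (alpha ^+ j) P))
  (d1 d2 : R) (hd1 : 0 < d1) (hd2 : 0 < d2)
  (hZ : forall t : R, 0 < t ->
    (`| heat_trace P t -
        (area P / (4 * pi * t) - perimeter b / (8 * Num.sqrt (pi * t))
         + corner_constant b)%:E |
     <= (d1 * expR (- (d2 / t)))%:E)%E) :
  let area_alpha := (1 - alpha ^+ 2)^-1 * area P in
  let perimeter_alpha := (1 - alpha)^-1 * perimeter b in
  let c_alpha := corner_constant b / (2 * ln alpha) in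
  exists p : R -> R,
    (forall x : R, p (x + 2 * ln (alpha^-1)) = p x) /\
    exists C : R, \forall t \near 0^'+,
      (`| heat_trace Palpha t -
          (area_alpha / (4 * pi * t) - perimeter_alpha / (8 * Num.sqrt (pi * t))
           + c_alpha * ln t + p (ln t))%:E |
       <= (C * expR (- (d2 / (alpha ^+ 2 * t))))%:E)%E.
Proof.
move=> area_alpha perimeter_alpha c_alpha.
have /andP[a0 a1] := halpha.
have q0 : 0 < alpha ^+ 2 by rewrite exprn_gt0.
have q1 : alpha ^+ 2 < 1 by rewrite exprn_ilt1// ltW.
pose S j x := T j (alpha ^+ j *: x).
have sS j : similarity (S j) ((alpha ^+ 2) ^+ j).
  by rewrite exprAC; apply: isometry_similarity; rewrite ?exprn_gt0.
have ME j : T j @` dilation (alpha ^+ j) P = S j @` P by rewrite /dilation image_comp.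
have [c c0 gap] := spectral_gap (polygon_bounded hP).
have mP0 nu : nu < c -> multiplicity P nu = 0%E.
  by move=> nuc; apply: multiplicity_eq0 => u; exact: gap.
have mS j nu : multiplicity (S j @` P) nu = multiplicity P ((alpha ^+ 2) ^+ j * nu).
  exact: multiplicity_similarity.
have qj0 j : 0 < (alpha ^+ 2) ^+ j by rewrite exprn_gt0.
(* The assumed bound puts the heat trace within a real distance of a real number, which excludes
   infinite values. *)
have fin t : 0 < t -> heat_trace P t = (fine (heat_trace P t))%:E.
  by move=> /hZ; case: (heat_trace P t).
pose Z t := fine (heat_trace P t).
have Z0 t : 0 <= Z t.
  by apply: fine_ge0; apply: nneseries_ge0 => j _ _; exact: expeR_ge0.
have trace t : 0 < t ->
    heat_trace Palpha t = (\sum_(0 <= j <oo) (Z (t / (alpha ^+ 2) ^+ j))%:E)%E.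
  move=> t0; rewrite (heat_trace_bigcup (M := fun j => S j @` P) t0).
    apply: eq_eseriesr => j _; rewrite (heat_trace_scale t0 (qj0 j) (mS j)).
    by rewrite fin// divr_gt0.
  move=> nu; rewrite hPalpha; under eq_bigcupr do rewrite ME.
  (* Scaling by [alpha ^+ j] divides the gap [c] of [P] by [(alpha ^+ 2) ^+ j], so the gaps of the
     pieces tend to infinity. *)
  apply: (@multiplicity_bigcup _ _ (fun j => c / (alpha ^+ 2) ^+ j)).
  - by move=> j; apply: similarity_open (sS j) (polygon_open hP).
  - by move: hdisj; under [X in trivIset _ X]eq_fun do rewrite ME.
  - move=> j mu u; rewrite ltr_pdivlMr// mulrC => muc.
    by move=> /(eigenspace_comp (sS j)) /(gap _ _ muc); exact: ae_comp_similarity.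
  - by move=> mu; exact: divr_exprn_unbounded.
have [||p [pper [C hC]]] := periodic_expansion (Z := Z) halpha (pi_gt0 R) hd1 hd2
    (A := area P) (L := perimeter b) (V := corner_constant b).
- by move=> s s0; have := hZ s s0; rewrite (fin _ s0) -EFinB abse_EFin lee_fin.
(* Decay from time [t] to [t / q ^ j] gives the factor [exp (t c) exp (- t c / q ^ j)], and the
   second exponential is at most [q ^ j / (t c)]. *)
- move=> t t0; exists (expR (t * c) * Z t / (t * c)) => j; rewrite ger0_norm//.
  have tc0 : 0 < t * c by rewrite mulr_gt0.
  have ts : t <= t / (alpha ^+ 2) ^+ j
    by apply: ler_peMr; [exact: ltW|rewrite invf_ge1// exprn_ile1// ltW].
  have := heat_trace_decay t0 ts mP0; rewrite (fin _ t0) (fin _ (divr_gt0 t0 (qj0 j))) -EFinM lee_fin.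
  move=> /le_trans; apply.
  have e1 : expR (- (t / (alpha ^+ 2) ^+ j * c)) <= (t * c)^-1 * (alpha ^+ 2) ^+ j.
    apply: le_trans (expR_Nle_inv _) _; first by rewrite mulr_gt0 ?divr_gt0.
    by rewrite !invfM invrK mulrAC.
  rewrite mulrBl opprB expRD -/(Z t) mulrAC -[leRHS]mulrA.
  by apply: ler_wpM2l => //; rewrite mulr_ge0 ?expR_ge0.
exists p; split => //; exists C; near=> t.
have t0 : 0 < t by near: t; exact: nbhs_right_gt.
have t1 : t <= 1 by near: t; exact: nbhs_right_le.
have [z hz] := hC t t0 t1.
rewrite trace//; have -> : (\sum_(0 <= j <oo) (Z (t / (alpha ^+ 2) ^+ j))%:E = z%:E)%E.
  apply: cvg_lim => //.
  rewrite (_ : (fun n => _) = EFin \o series (fun j => Z (t / (alpha ^+ 2) ^+ j))).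
    by apply: cvg_EFin => //; exact: nearW.
  by apply/funext => n; rewrite /= sumEFin seriesEnat.
by rewrite -EFinB abse_EFin lee_fin.
Unshelve. all: by end_near. Qed.
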